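(* Let $\Omega\subset\mathbb{R}^n$ be a bounded $C^2$ domain. Let $0\le f\in C^{\alpha}(\overline{\Omega})$ for some $0<\alpha<1$ satisfy $\delta_1=\inf_\Omega f>0$, and let $0<g\in C^2((-\infty,1))$ satisfy $g'(s)\le 0$ and $\left(\frac1g\right)''(s)\ge0$ for all $s<1$. Let $\lambda_1=\frac{\mu_1}{\delta_1}\sup_{0\le s<1}s\,g(s)$. Then for any solution $u$ of (P) with initial value $u_0$ and $\lambda>\lambda_1$, the touchdown time $T_\lambda$ of $u$ satisfies $$T_\lambda\le\frac{1}{(\lambda-\lambda_1)\delta_1}\int_{E(0)}^1g(s)\,ds,\qquad\text{where } E(0)=\int_\Omega u_0\phi_1\,dx.$$ Moreover, if $g$ also satisfies $g(s)\to0$ as $s\nearrow1$, then there exists a constant $a_0<1$ such that if $$\int_\Omega u_0\phi_1\,dx\ge a_0,$$ then for any solution $u$ of (P) with $\lambda>0$ and initial value $u_0$ we have $T_\lambda\le(1-a_0)/10$.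
   Context: (P) denotes the problem $u_t=\Delta u+\lambda f(x)/g(u)$ in $\Omega\times(0,T)$, $u=0$ on $\partial\Omega\times(0,T)$, $u(x,0)=u_0$ in $\Omega$, where $u_0\in L^1(\Omega)$ satisfies $u_0\le a$ in $\Omega$ for some constant $a\in(0,1)$. A solution of (P) in $\Omega\times(0,T)$ is a function $u\in C^{2,1}(\Omega\times(0,T))\cap C(\overline{\Omega}\times(0,T))$ (with $C^{2,1}$ meaning that $u,u_t,u_{x_i},u_{x_ix_j}$ are continuous) satisfying the equation, $u=0$ on $\partial\Omega\times(0,T)$, $\sup_{\overline{\Omega}\times(0,T']}u<1$ for all $0<T'<T$, and $\|u(\cdot,t)-u_0\|_{L^1(\Omega)}\to 0$ as $t\to 0$. The touchdown time $T_\lambda>0$ of a solution $u$ is the time such that $\sup_\Omega u(\cdot,t)<1$ for all $0<t<T_\lambda$ and $\lim_{t\nearrow T_\lambda}\sup_\Omega u(\cdot,t)=1$. $\mu_1>0$ is the first Dirichlet eigenvalue of $-\Delta$ in $\Omega$ and $\phi_1$ is the corresponding positive eigenfunction normalized by $\int_\Omega\phi_1\,dx=1$.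
   Formalization: In the ''Moreover'' part the constant a_0 may depend on the fixed λ>0 (not on u_0 or u); a single a_0 for all λ>0 is impossible, since for a fixed u_0 touchdown is delayed arbitrarily long as λ→0. *)

(* Defs.v *)
From HB Require Import structures.
From mathcomp Require Import all_boot all_order all_algebra.
From mathcomp Require Import all_classical all_reals all_analysis.
Set Implicit Arguments.
Unset Strict Implicit.
Unset Printing Implicit Defensive.
Import Order.TTheory GRing.Theory Num.Theory numFieldNormedType.Exports.
Local Open Scope classical_set_scope.
Local Open Scope ring_scope.

(* R^n is 'rV[R]_n. The library norm and balls on it are those of the sup norm;
   being equivalent to the Euclidean ones, they give the same topology, bounded
   sets and Hoelder functions. *)

(* The Borel sigma-algebra of R^n, as the one generated by the coordinates; the
   library has this structure on tuples but not on row vectors. *)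
Definition measure_rV_display : measure_display.
Proof. exact: default_measure_display. Qed.

Section measurable_rV.
Context (R : realType) (n : nat).

Let coors : 'I_n -> 'rV[R]_n -> measurableTypeR R := fun i x => x 0 i.

Let rV_set0 : g_sigma_preimage coors set0.
Proof. exact: sigma_algebra0. Qed.

Let rV_setC A : g_sigma_preimage coors A -> g_sigma_preimage coors (~` A).
Proof. exact: sigma_algebraC. Qed.

Let rV_bigcup (F : _^nat) : (forall i, g_sigma_preimage coors (F i)) ->
  g_sigma_preimage coors (\bigcup_i (F i)).
Proof. exact: sigma_algebra_bigcup. Qed.

HB.instance Definition _ := @isMeasurable.Build measure_rV_display
  'rV[R]_n (g_sigma_preimage coors) rV_set0 rV_setC rV_bigcup.

End measurable_rV.

Section lebesgue_rV.
Context (R : realType).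

Lemma measurable_coord n (i : 'I_n) :
  measurable_fun [set: 'rV[R]_n]
    (fun x : 'rV[R]_n => x 0 i : measurableTypeR R).
Proof.
move=> _ Y mY; rewrite setTI; apply: sub_sigma_algebra => /=.
rewrite -bigcup_seq/=; exists i => /=; first by rewrite mem_index_enum.
by exists Y => //; rewrite setTI.
Qed.

Lemma measurable_fun_rV d (T : measurableType d) n (f : T -> 'rV[R]_n) :
  (forall i, measurable_fun setT (fun x => f x 0 i : measurableTypeR R)) ->
  measurable_fun setT f.
Proof.
move=> mf; suff : g_sigma_preimage
    (fun i x => f x 0 i : measurableTypeR R) `<=` measurable.
  have -> : (fun i x => f x 0 i : measurableTypeR R) =
    (fun i => (fun y : 'rV[R]_n => y 0 i) \o f) by [].
  by rewrite g_sigma_preimage_comp => H _ A mA; apply: H; exists A.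
apply: smallest_sub; first exact: sigma_algebra_measurable.
rewrite -bigcup_seq => A [i _ [B mB <-]]; exact: mf.
Qed.

Definition cons_rV n (p : R * 'rV[R]_n) : 'rV[R]_n.+1 := row_mx p.1%:M p.2.

Definition uncons_rV n (x : 'rV[R]_n.+1) : R * 'rV[R]_n :=
  (x 0 0, rsubmx (x : 'rV[R]_(1 + n))).

Lemma uncons_rVK n : cancel (@uncons_rV n) (@cons_rV n).
Proof.
move=> x; rewrite /cons_rV /uncons_rV /= -[RHS](@hsubmxK _ 1 1 n).
apply: (f_equal2 (@row_mx R 1 1 n)) => //; apply/rowP => i; rewrite !ord1 !mxE eqxx mulr1n.
by congr (x _ _); apply/val_inj.
Qed.

Lemma cons_rVK n : cancel (@cons_rV n) (@uncons_rV n).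
Proof.
move=> [a y]; rewrite /cons_rV /uncons_rV /= row_mxKr; congr pair.
have -> : 0 = lshift n (0 : 'I_1) :> 'I_(1 + n) by apply/val_inj.
by rewrite (@row_mxEl _ 1 1 n) mxE eqxx mulr1n.
Qed.

Lemma measurable_cons_rV n : measurable_fun setT (@cons_rV n).
Proof.
apply: measurable_fun_rV => i; case: (@splitP 1 n i) => j ij.
- have -> : i = lshift n j by apply/val_inj.
  rewrite (_ : (fun x => _) = fst); first exact: measurable_fst.
  by apply/funext => -[a y]; rewrite /cons_rV (@row_mxEl _ 1 1 n) ord1 mxE eqxx
    mulr1n.
- have -> : i = rshift 1 j by apply/val_inj.
  rewrite (_ : (fun x => _) =
    (fun y : 'rV[R]_n => y 0 j : measurableTypeR R) \o snd).
    by apply: measurableT_comp => //; exact: measurable_coord.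
  by apply/funext => -[a y]; rewrite /cons_rV (@row_mxEr _ 1 1 n).
Qed.

Lemma measurable_uncons_rV n :
  measurable_fun setT (@uncons_rV n : _ -> measurableTypeR R * 'rV[R]_n).
Proof.
apply/measurable_fun_pairP; split; first exact: measurable_coord.
apply: measurable_fun_rV => i.
rewrite (_ : (fun x => _) =
  (fun x : 'rV[R]_n.+1 => x 0 (rshift 1 i) : measurableTypeR R)).
  exact: measurable_coord.
by apply/funext => x; rewrite /= mxE.
Qed.

(* n-fold product of the Lebesgue measure of R *)
Fixpoint lebesgue_rV n : set 'rV[R]_n -> \bar R :=
  match n with
  | 0 => \d_(0 : 'rV[R]_0)
  | m.+1 => pushforward (lebesgue_measure \x @lebesgue_rV m)%E (@cons_rV m)
  end.

Lemma lebesgue_rV_measure n :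
  exists m : {sigma_finite_measure set 'rV[R]_n -> \bar R},
    @lebesgue_rV n = m.
Proof.
elim: n => [|n [m mE]]; first by exists \d_(0 : 'rV[R]_0).
pose mu : {sigma_finite_measure set (measurableTypeR R) -> \bar R} :=
  lebesgue_measure.
pose q : {measure set 'rV[R]_n.+1 -> \bar R} :=
  measure_function_pushforward__canonical__measure_function_Measure
    (mu \x m)%E (@measurable_cons_rV n).
have fq : sigma_finite setT q.
  have /sigma_finiteP[F [TF ndF Foo]] := sigma_finiteT mu.
  have /sigma_finiteP[G [TG ndG Goo]] := sigma_finiteT m.
  exists (fun k => @uncons_rV n @^-1` (F k `*` G k)).
    rewrite -preimage_bigcup -[LHS](preimage_setT (@uncons_rV n)).
    congr (_ @^-1` _); rewrite -setXTT TF TG predeqE => -[x y]; split.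
      move=> [/= [i _ Fix] [k _ Gky]]; exists (maxn i k) => //; split.
      - by move: x Fix; exact/subsetPset/ndF/leq_maxl.
      - by move: y Gky; exact/subsetPset/ndG/leq_maxr.
    by move=> [i _ []/= ? ?]; split; exists i.
  move=> k; have [mF Fk] := Foo k; have [mG Gk] := Goo k; split.
    rewrite -[X in measurable X]setTI; apply: measurable_uncons_rV => //.
    exact: measurableX.
  rewrite /q /= /pushforward -comp_preimage (_ : _ \o _ = id); last first.
    by apply/funext => x; exact: cons_rVK.
  rewrite preimage_id product_measure1E//.
  by rewrite lte_mul_pinfty// ge0_fin_numE.
pose qS := Measure_isSigmaFinite.Build _ _ _ q fq.
pose q' : {sigma_finite_measure set 'rV[R]_n.+1 -> \bar R} :=
  HB.pack_for (SigmaFiniteMeasure.type 'rV[R]_n.+1 R) (Measure.sort q) qS.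
by exists q'; rewrite /= mE.
Qed.

Let lebesgue_rV0 n : @lebesgue_rV n set0 = 0%E.
Proof. by have [m ->] := lebesgue_rV_measure n; exact: measure0. Qed.

Let lebesgue_rV_ge0 n A : (0 <= @lebesgue_rV n A)%E.
Proof. by have [m ->] := lebesgue_rV_measure n; exact: measure_ge0. Qed.

Let lebesgue_rV_sigma_additive n : semi_sigma_additive (@lebesgue_rV n).
Proof.
by have [m ->] := lebesgue_rV_measure n; exact: measure_semi_sigma_additive.
Qed.

HB.instance Definition _ n := isMeasure.Build _ _ _ (@lebesgue_rV n)
  (lebesgue_rV0 n) (@lebesgue_rV_ge0 n) (@lebesgue_rV_sigma_additive n).

Let lebesgue_rV_sigma_finite n : sigma_finite setT (@lebesgue_rV n).
Proof. by have [m ->] := lebesgue_rV_measure n; exact: sigma_finiteT. Qed.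

HB.instance Definition _ n := Measure_isSigmaFinite.Build _ _ _
  (@lebesgue_rV n) (lebesgue_rV_sigma_finite n).

End lebesgue_rV.
Arguments lebesgue_rV R n : clear implicits.

Section problem.
Context (R : realType) (n : nat).
Implicit Types (Omega A : set 'rV[R]_n) (w phi f : 'rV[R]_n -> R).
Implicit Types (u : 'rV[R]_n -> R -> R) (g : R -> R) (T : \bar R).

Definition partial (i : 'I_n) w (x : 'rV[R]_n) : R := 'D_(delta_mx 0 i) w x.

Definition laplacian w (x : 'rV[R]_n) : R :=
  \sum_(i < n) partial i (partial i w) x.

Record C2_on A w : Prop := {
  C2_cont : forall x, A x -> {for x, continuous w} ;
  C2_derivable : forall i x, A x -> derivable w x (delta_mx 0 i) ;
  C2_cont_partial : forall i x, A x -> {for x, continuous (partial i w)} ;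
  C2_derivable2 : forall i j x, A x ->
    derivable (partial i w) x (delta_mx 0 j) ;
  C2_cont_partial2 : forall i j x, A x ->
    {for x, continuous (partial j (partial i w))} }.

Definition boundary A : set 'rV[R]_n := closure A `\` interior A.

(* Near each boundary point, Omega is the part of space on one side of a C^2
   graph over one of the coordinate hyperplanes; a function of the other n - 1
   coordinates is rendered as one that does not depend on x_i. *)
Definition C2_boundary Omega : Prop :=
  forall x0, boundary Omega x0 ->
  exists (i : 'I_n) (sg : bool) (r : R) (gamma : 'rV[R]_n -> R),
    [/\ 0 < r, C2_on setT gamma,
        forall x c, gamma (x + c *: delta_mx 0 i) = gamma x &
        forall x, ball x0 r x -> (Omega x <-> gamma x < (-1) ^+ sg * x 0 i)].

Record bounded_C2_domain Omega : Prop := {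
  domain_nonempty : Omega !=set0 ;
  domain_open : open Omega ;
  domain_connected : connected Omega ;
  domain_bounded : bounded_set Omega ;
  domain_C2 : C2_boundary Omega }.

Definition hoelder_on A (alpha : R) w : Prop :=
  exists K : R, forall x y, A x -> A y -> `|w x - w y| <= K * `|x - y| `^ alpha.

(* g is only meaningful on (-oo, 1); its values elsewhere are irrelevant. *)
Definition C2_below1 g : Prop :=
  forall s, s < 1 -> [/\ derivable g s 1, derivable (derive1 g) s 1 &
                         {for s, continuous (derive1 (derive1 g))}].

Record dirichlet_eigenfunction Omega (mu : R) phi : Prop := {
  eigen_C2 : C2_on Omega phi ;
  eigen_cont : {within closure Omega, continuous phi} ;
  eigen_eq : forall x, Omega x -> - laplacian phi x = mu * phi x ;
  eigen_bnd : forall x, boundary Omega x -> phi x = 0 ;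
  eigen_neq0 : exists2 x, Omega x & phi x != 0 }.

Definition first_dirichlet_eigenvalue Omega (mu1 : R) : Prop :=
  (exists phi, dirichlet_eigenfunction Omega mu1 phi) /\
  forall mu phi, dirichlet_eigenfunction Omega mu phi -> mu1 <= mu.

Record initial_datum Omega (u0 : 'rV[R]_n -> R) : Prop := {
  datum_L1 : (lebesgue_rV R n).-integrable Omega (EFin \o u0) ;
  datum_le : exists a : R, [/\ 0 < a, a < 1 &
    {ae lebesgue_rV R n, forall x, Omega x -> u0 x <= a}] }.

(* (0, T), where T may be +oo *)
Definition time_interval T : set R := [set t | 0 < t /\ (t%:E < T)%E].

Record C21_on A (I : set R) u : Prop := {
  C21_cont : forall x t, A x -> I t ->
    {for (x, t), continuous (fun p : 'rV[R]_n * R => u p.1 p.2)} ;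
  C21_derivable_t : forall x t, A x -> I t -> derivable (u x) t 1 ;
  C21_cont_t : forall x t, A x -> I t ->
    {for (x, t), continuous (fun p : 'rV[R]_n * R => derive1 (u p.1) p.2)} ;
  C21_derivable_x : forall i x t, A x -> I t ->
    derivable (u ^~ t) x (delta_mx 0 i) ;
  C21_cont_x : forall i x t, A x -> I t ->
    {for (x, t), continuous
      (fun p : 'rV[R]_n * R => partial i (u ^~ p.2) p.1)} ;
  C21_derivable_xx : forall i j x t, A x -> I t ->
    derivable (partial i (u ^~ t)) x (delta_mx 0 j) ;
  C21_cont_xx : forall i j x t, A x -> I t ->
    {for (x, t), continuous
      (fun p : 'rV[R]_n * R => partial j (partial i (u ^~ p.2)) p.1)} }.

Record is_solution Omega f g (lambda : R) (u0 : 'rV[R]_n -> R) T u : Prop := {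
  sol_C21 : C21_on Omega (time_interval T) u ;
  sol_cont : {within closure Omega `*` time_interval T,
    continuous (fun p : 'rV[R]_n * R => u p.1 p.2)} ;
  sol_eq : forall x t, Omega x -> time_interval T t ->
    derive1 (u x) t = laplacian (u ^~ t) x + lambda * f x / g (u x t) ;
  sol_bnd : forall x t, boundary Omega x -> time_interval T t -> u x t = 0 ;
  sol_lt1 : forall T' : R, time_interval T T' ->
    (ereal_sup [set (u p.1 p.2)%:E | p in
       closure Omega `*` [set t | 0 < t <= T']%R] < 1)%E ;
  sol_init : (fun t => \int[lebesgue_rV R n]_(x in Omega)
      `|(u x t - u0 x)%:E|)%E @ 0^'+ --> 0%E }.

Definition sup_at Omega u (t : R) : \bar R :=
  ereal_sup [set (u x t)%:E | x in Omega].

(* A function which stays below 1 for all times has touchdown time +oo. *)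
Record touchdown_time Omega u T : Prop := {
  touchdown_gt0 : (0 < T)%E ;
  touchdown_before : forall t, time_interval T t -> (sup_at Omega u t < 1)%E ;
  touchdown_at : forall r : R, T = r%:E ->
    sup_at Omega u t @[t --> r^'-] --> 1%E }.

End problem.

(* Main.v *)
Require Import Defs.
From HB Require Import structures.
From mathcomp Require Import all_boot all_order all_algebra.
From mathcomp Require Import all_classical all_reals all_analysis.
From mathcomp Require Import measurable_realfun ring lra.
Import Order.TTheory GRing.Theory Num.Theory numFieldNormedType.Exports.
Local Open Scope classical_set_scope.
Local Open Scope ring_scope.

(** The average E(t) of u(., t) against phi1 should satisfy
    E' >= - mu1 E + lambda delta1 / g(E), by Green's identity and Jensen's
    inequality for the convex function 1/g. No regularity of u up to the
    boundary is available, so phi1 is replaced by eta(phi1), where eta is a C^2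
    convex function vanishing on (-oo, e] and affine with slope 1 on
    [2e, +oo). This weight has compact support in Omega, and
      int eta(phi1) Delta u
        = int u (eta''(phi1) |grad phi1|^2 + eta'(phi1) Delta phi1).
    The same identity with u = 1 bounds int eta''(phi1) |grad phi1|^2 by mu1,
    while on the support of eta''(phi1), close to the boundary of Omega, u is
    uniformly small on compact time intervals. Hence the weighted averages are
    differentiable, converge uniformly to E as e -> 0, and satisfy the
    differential inequality up to a vanishing error.

    For lambda > lambda1 the right-hand side is at least
    (lambda - lambda1) delta1 / g(E), so that an antiderivative of g evaluated
    at E grows at least at the constant rate (lambda - lambda1) delta1.
    If g tends to 0 at 1, the tangent to 1/g at a point a0 close to 1 gives the
    linear inequality E' >= 10 + r (E - a0) with r >= 0, hence
    E(t) >= a0 + 10 t. *)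

(** * Lebesgue measure on row vectors *)

Section measure_rV.
Context {R : realType}.

Lemma le_norm_rV n (x : 'rV[R]_n) (B : R) : 0 <= B ->
  (`|x| <= B <-> forall i, `|x 0 i| <= B).
Proof.
move=> B0; rewrite [`|x|]/Num.norm /= mx_normrE; split.
  by move=> /bigmax_leP[_ /= xB] i; have := xB (0, i) isT.
by move=> xB; apply/bigmax_leP; split => //= -[a i] _ /=; rewrite ord1.
Qed.

Lemma coord_le_norm n (x : 'rV[R]_n) i : `|x 0 i| <= `|x|.
Proof. by have /le_norm_rV := lexx `|x|; exact. Qed.

Lemma cons_rV0 n (a : R) (y : 'rV[R]_n) : cons_rV (a, y) 0 0 = a.
Proof.
have -> : 0 = lshift n (0 : 'I_1) :> 'I_(1 + n) by apply/val_inj.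
by rewrite /cons_rV (@row_mxEl _ 1 1 n) mxE eqxx mulr1n.
Qed.

Lemma cons_rV_lift n (a : R) (y : 'rV[R]_n) i :
  cons_rV (a, y) 0 (lift 0 i) = y 0 i.
Proof.
have -> : lift 0 i = rshift 1 i :> 'I_(1 + n) by apply/val_inj.
by rewrite /cons_rV (@row_mxEr _ 1 1 n).
Qed.

Lemma rV_eqP n (x y : 'rV[R]_n.+1) :
  x 0 0 = y 0 0 -> (forall i, x 0 (lift 0 i) = y 0 (lift 0 i)) -> x = y.
Proof.
move=> h0 hS; apply/rowP => i.
by have [j ->|->] := unliftP 0 i.
Qed.

(** The sigma-algebra is generated by the coordinates, which makes boxes measurable. An open set is
    the union of the boxes with rational centre and rational radius that it contains, and there are
    only countably many of them. *)
Lemma open_measurable_rV n (A : set 'rV[R]_n) : open A -> measurable A.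
Proof.
move=> oA.
pose box (q : 'rV[rat]_n) (r : rat) : set 'rV[R]_n :=
  \big[setI/setT]_(i < n) [set y : 'rV[R]_n | `|y 0 i - ratr (q 0 i)| < ratr r].
have boxP q r y : box q r y <-> forall i, `|y 0 i - ratr (q 0 i)| < ratr r.
  rewrite /box -bigcap_seq; split => [H i|H i _]; last exact: H.
  by apply: H => /=; rewrite mem_index_enum.
have mbox q r : measurable (box q r).
  apply: bigsetI_measurable => i _.
  rewrite (_ : mkset _ = (fun x : 'rV[R]_n => x 0 i : measurableTypeR R) @^-1`
     (ball (ratr (q 0 i) : R) (ratr r))).
    rewrite -[X in measurable X]setTI; apply: measurable_coord => //.
    by apply: open_measurable; exact: ball_open.
  by apply/seteqP; split => y /=; rewrite /ball /= distrC.
have -> : A = \bigcup_(p : 'rV[rat]_n * rat)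
    (if pselect (box p.1 p.2 `<=` A) then box p.1 p.2 else set0).
  apply/seteqP; split => [x Ax|x [p _]]; last by case: pselect => // H /H.
  have /nbhs_ballP[e /= e0 xeA] : nbhs x A by exact: open_nbhs_nbhs.
  (* With radius below e/2 and centre within that radius of x, every point of the box is at distance
     less than e from x. *)
  have [r] : exists r : rat, ratr r \in `]0, (e / 2)[%R.
    by apply: rat_in_itvoo; rewrite divr_gt0.
  rewrite in_itv /= => /andP[r0 re].
  have qP i : exists q : rat, ratr q \in `](x 0 i - ratr r), (x 0 i + ratr r)[%R.
    by apply: rat_in_itvoo; rewrite ltrBlDr -addrA ltrDl addr_gt0.
  pose q : 'rV[rat]_n := \row_i xchoose (qP i).
  have qx i : `|x 0 i - ratr (q 0 i)| < ratr r.
    have := xchooseP (qP i); rewrite in_itv /= mxE => /andP[h1 h2].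
    by rewrite ltr_distlC h1 h2.
  exists (q, r) => //=; case: pselect => [H|H]; first exact/boxP.
  exfalso; apply: H => y /boxP yq; apply: xeA; split => // i j; rewrite ord1 /ball /=.
  rewrite (_ : _ - _ = (x 0 j - ratr (q 0 j)) - (y 0 j - ratr (q 0 j))); last by ring.
  rewrite (le_lt_trans (ler_normB _ _))// (splitr e).
  by rewrite ltrD// (lt_trans _ re).
apply: countable_bigcupT_measurable; first exact: countableP.
by move=> p; case: pselect => ? /=; [exact: mbox|exact: measurable0].
Qed.

Lemma continuous_measurable_rV n (A : set 'rV[R]_n) (F : 'rV[R]_n -> R) :
  open A -> (forall x, A x -> {for x, continuous F}) -> measurable_fun A F.
Proof.
move=> oA cF; apply: (measurability _ (RGenOInfty.measurableE R)) => //.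
move=> _ [_ [r ->] <-]; apply: open_measurable_rV.
rewrite openE => x [Ax /=]; rewrite in_itv /= andbT => rFx.
apply: filterI; first exact: open_nbhs_nbhs.
have /cvgr_gt/(_ _ rFx) := cF x Ax.
by apply: filterS => y /=; rewrite in_itv /= andbT.
Qed.

Lemma closed_norm_le (V : normedModType R) (B : R) : closed [set x : V | `|x| <= B].
Proof.
apply: (@preimage_closed _ _ _ [set y : R | y <= B]); last exact: closed_le.
by move=> x _; exact: norm_continuous.
Qed.

Lemma measurable_norm_le n (B : R) : measurable [set x : 'rV[R]_n | `|x| <= B].
Proof.
rewrite -[X in measurable X]setCK; apply: measurableC; apply: open_measurable_rV.
by rewrite openC; exact: closed_norm_le.
Qed.

(** A ball of the sup norm lies in the product of an interval and a ball of one dimension less, so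
    induction on the dimension applies to the product measure. *)
Lemma lebesgue_rV_ball_lty n (B : R) : 0 <= B ->
  (lebesgue_rV R n [set x | (`|x| <= B)%R] < +oo)%E.
Proof.
move=> B0.
have mS k : measurable [set x : 'rV[R]_k | `|x| <= B] := measurable_norm_le k B.
elim: n => [|n IH].
  rewrite /= diracE; exact: ltry.
rewrite /= /pushforward.
apply: (@le_lt_trans _ _ ((lebesgue_measure \x lebesgue_rV R n)%E
   (`[(- B), B] `*` [set x : 'rV[R]_n | `|x| <= B]))).
  apply: le_measure; rewrite ?inE.
  - rewrite -[X in measurable X]setTI; apply: measurable_cons_rV => //; exact: mS.
  - apply: measurableX; last exact: mS; exact: measurable_itv.
  - move=> [a y] /= /(le_norm_rV _ _ _ B0) H; split => /=.
      by rewrite in_itv /= -ler_norml -{1}(cons_rV0 _ a y).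
    apply/le_norm_rV => // i; rewrite -(cons_rV_lift _ a y); exact: H.
rewrite product_measure1E; [|exact: measurable_itv|exact: mS].
apply: lte_mul_pinfty; [exact: measure_ge0| |exact: IH].
suff : lebesgue_measure `[- B, B]%classic \is a fin_num by [].
by rewrite lebesgue_measure_itv /=; case: ifP.
Qed.

End measure_rV.

(** * Integrals of partial derivatives *)

Section divergence.
Context {R : realType}.

Lemma integrable_bounded_support d (T : measurableType d)
    (mu : {measure set T -> \bar R}) (D : set T) (f : T -> R) (M : R) :
  measurable D -> (mu D < +oo)%E -> measurable_fun setT f ->
  (forall x, `|f x| <= M) -> (forall x, ~ D x -> f x = 0) ->
  mu.-integrable setT (EFin \o f).
Proof.
move=> mD Doo mf fM f0.
have -> : EFin \o f = (EFin \o f) \_ D.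
  apply/funext => x; rewrite patchE; case: ifPn => //= /negP; rewrite inE => xD.
  by rewrite f0.
apply/(integrable_mkcond _ mD); apply: measurable_bounded_integrable => //.
  exact: measurable_funTS.
exists M; split; first exact: num_real.
by move=> y My x _ /=; rewrite (le_trans (fM x))// ltW.
Qed.

(** A directional derivative depends only on the values along a line. This moves derivatives between
    spaces of different dimension: slices by fixed coordinates, shifts, restrictions to lines. *)
Lemma is_derive_congr (V1 V2 W : normedModType R) (F : V1 -> W) (G : V2 -> W)
    x1 v1 x2 v2 d :
  (forall h : R, F (h *: v1 + x1) = G (h *: v2 + x2)) ->
  is_derive x1 v1 F d -> is_derive x2 v2 G d.
Proof.
move=> FG [dF Fd].
have E : (fun h : R => h^-1 *: ((F \o shift x1) (h *: v1) - F x1)) =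
         (fun h : R => h^-1 *: ((G \o shift x2) (h *: v2) - G x2)).
  apply/funext => h /=; rewrite FG.
  by have := FG 0; rewrite !scale0r !add0r => ->.
by split; [move: dF; rewrite /derivable E|rewrite -Fd /derive E].
Qed.

Lemma integral_derive_eq0 (F dF : R -> R) (B : R) : 0 < B ->
  (forall x : R, is_derive x 1 F (dF x)) -> continuous dF ->
  (forall x, B <= `|x| -> F x = 0) -> (forall x, B <= `|x| -> dF x = 0) ->
  (\int[lebesgue_measure]_x (dF x)%:E = 0)%E.
Proof.
move=> B0 FdF cdF F0 dF0.
have cF : continuous F.
  by move=> x; apply/differentiable_continuous/derivable1_diffP; case: (FdF x).
transitivity (\int[lebesgue_measure]_(x in `[(- B)%R, B]) (dF x)%:E)%E.
  rewrite [RHS]integral_mkcond; apply: eq_integral => x _.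
  rewrite patchE; case: ifPn => //; rewrite notin_setE /= in_itv /= -ler_norml.
  by move/negP; rewrite -ltNge => /ltW Bx; rewrite dF0.
rewrite (@continuous_FTC2 _ dF F).
- by rewrite !F0 ?normrN ?gtr0_norm// subee.
- by rewrite gtrN.
- exact: continuous_subspaceT.
- split.
  + by move=> x _; case: (FdF x).
  + by apply: cvg_at_right_filter; exact: cF.
  + by apply: cvg_at_left_filter; exact: cF.
- by move=> x _; rewrite derive1E; case: (FdF x).
Qed.

Lemma cons_rV_continuous1 n (y : 'rV[R]_n) :
  continuous (fun a : R => cons_rV (a, y)).
Proof.
move=> a A [P nP PA]; have := nP 0 0; rewrite cons_rV0 /=.
apply: filterS => b Pb; apply: PA => i j; rewrite ord1.
have [k ->|->] := unliftP 0 j; last by rewrite cons_rV0.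
by have /nbhs_singleton := nP 0 (lift 0 k); rewrite !cons_rV_lift.
Qed.

Lemma cons_rV_continuous2 n (a : R) :
  continuous (fun y : 'rV[R]_n => cons_rV (a, y)).
Proof.
move=> y A [P nP PA]; exists (fun _ k => P 0 (lift 0 k)).
  by move=> i k; have := nP 0 (lift 0 k); rewrite cons_rV_lift ord1.
move=> z Pz; apply: PA => i j; rewrite ord1.
have [k ->|->] := unliftP 0 j; first by rewrite cons_rV_lift; exact: (Pz 0).
by have /nbhs_singleton := nP 0 0; rewrite !cons_rV0.
Qed.

Lemma coord_scaleD n (h : R) (v x : 'rV[R]_n) j :
  (h *: v + x) 0 j = h * v 0 j + x 0 j.
Proof. by rewrite !mxE. Qed.

Lemma norm_cons_rV n (a : R) (y : 'rV[R]_n) :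
  `|a| <= `|cons_rV (a, y)| /\ `|y| <= `|cons_rV (a, y)|.
Proof.
split; first by rewrite -{1}(cons_rV0 _ a y) coord_le_norm.
by apply/le_norm_rV => // i; rewrite -(cons_rV_lift _ a y) coord_le_norm.
Qed.

Lemma bounded_continuous_support n (F : 'rV[R]_n -> R) (B : R) :
  continuous F -> (forall x, B <= `|x| -> F x = 0) ->
  exists M : R, forall x, `|F x| <= M.
Proof.
move=> cF F0.
have cK : compact [set x : 'rV[R]_n | `|x| <= B].
  apply: bounded_closed_compact.
    by exists B; split; [exact: num_real|move=> y By x /= xB; rewrite (le_trans xB)// ltW].
  exact: closed_norm_le.
have [K [_ KF]] : bounded_set (F @` [set x : 'rV[R]_n | `|x| <= B]).
  apply: compact_bounded; apply: continuous_compact => //.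
  exact: continuous_subspaceT.
exists (`|K| + 1) => x; have [xB|xB] := leP `|x| B.
  by apply: KF; [rewrite (le_lt_trans (ler_norm _))// ltrDl|exists x].
by rewrite F0 ?normr0 ?addr_ge0// ltW.
Qed.

(** By Fubini. If i is the first coordinate, the inner integral is taken along it and vanishes by
    the fundamental theorem of calculus. Otherwise the first coordinate is frozen and the induction
    hypothesis treats the slices. *)
Lemma integral_partial_eq0 n (i : 'I_n) (F dF : 'rV[R]_n -> R) (B : R) : 0 < B ->
  (forall x, is_derive x (delta_mx 0 i) F (dF x)) -> continuous dF ->
  (forall x, B <= `|x| -> F x = 0) -> (forall x, B <= `|x| -> dF x = 0) ->
  (\int[lebesgue_rV R n]_x (dF x)%:E = 0)%E.
Proof.
elim: n i F dF => [[]//|n IH] i F dF B0 FdF cdF F0 dF0.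
have [M dFM] := bounded_continuous_support _ _ _ cdF dF0.
have mdF : measurable_fun setT dF.
  by apply: continuous_measurable_rV => [|x _]; [exact: openT|exact: cdF].
have mcS := measurable_norm_le n.+1 B.
pose mu : {measure set (measurableTypeR R * 'rV[R]_n) -> \bar R} :=
  (lebesgue_measure \x lebesgue_rV R n)%E.
have idF : (lebesgue_measure \x lebesgue_rV R n)%E.-integrable setT
    (EFin \o (dF \o @cons_rV R n)).
  apply: (@integrable_bounded_support _ _ mu (@cons_rV R n @^-1` [set x | `|x| <= B]) _ M).
  - rewrite -[X in measurable X]setTI; apply: measurable_cons_rV => //; exact: mcS.
  - exact: (lebesgue_rV_ball_lty n.+1 B (ltW B0)).
  - apply: measurableT_comp => //; exact: measurable_cons_rV.
  - by move=> x; exact: dFM.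
  - by move=> x /= /negP; rewrite -ltNge => /ltW; exact: dF0.
transitivity (\int[(lebesgue_measure \x lebesgue_rV R n)%E]_z (dF (cons_rV z))%:E)%E.
  rewrite /= integral_pushforward//.
  - exact: measurable_cons_rV.
  - exact/measurable_EFinP.
have [j ij|i0] := unliftP 0 i.
- rewrite -integral12_prod_meas1//= /fubini_F.
  rewrite -[RHS](integral0 lebesgue_measure setT); apply: eq_integral => a _ /=.
  apply: (IH j (fun y => F (cons_rV (a, y)))) => //.
  + move=> y; apply: is_derive_congr (FdF (cons_rV (a, y))) => h; congr F.
    apply: rV_eqP => [|k]; rewrite !(coord_scaleD, cons_rV0, cons_rV_lift) ij !mxE.
      by rewrite eqxx /= mulr0 add0r.
    by rewrite eqxx /= (inj_eq (@lift_inj _ _)).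
  + move=> y; apply: (@continuous_comp _ _ _ (fun y => cons_rV (a, y)) dF).
      exact: cons_rV_continuous2.
    exact: cdF.
  + by move=> y By; apply: F0; rewrite (le_trans By)//; case: (norm_cons_rV _ a y).
  + by move=> y By; apply: dF0; rewrite (le_trans By)//; case: (norm_cons_rV _ a y).
- rewrite -integral21_prod_meas1//= /fubini_G.
  rewrite -[RHS](integral0 (lebesgue_rV R n) setT); apply: eq_integral => y _ /=.
  apply: (integral_derive_eq0 (fun a => F (cons_rV (a, y))) _ B) => //.
  + move=> a; apply: is_derive_congr (FdF (cons_rV (a, y))) => h; congr F.
    apply: rV_eqP => [|k]; rewrite !(coord_scaleD, cons_rV0, cons_rV_lift) i0 !mxE.
      by rewrite eqxx.
    by rewrite eqxx /= mulr0 add0r.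
  + move=> a; apply: (@continuous_comp _ _ _ (fun a => cons_rV (a, y)) dF).
      exact: cons_rV_continuous1.
    exact: cdF.
  + by move=> a Ba; apply: F0; rewrite (le_trans Ba)//; case: (norm_cons_rV _ a y).
  + by move=> a Ba; apply: dF0; rewrite (le_trans Ba)//; case: (norm_cons_rV _ a y).
Qed.

End divergence.

(** * Cutoff functions *)

Section profile.
Context {R : realType}.
Implicit Types s t h : R.

Definition pospart s : R := Num.max s 0.

Lemma is_derive_ext {V W : normedModType R} {F G : V -> W} {x v d d'} :
  is_derive x v F d -> (forall y, F y = G y) -> d = d' -> is_derive x v G d'.
Proof. by move=> H /funext FG <-; rewrite -FG. Qed.

(** A quadratic remainder estimate reduces differentiability of powers of the positive part to
    polynomial inequalities, with the knot at 0 treated like any other point. *)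
Lemma is_derive_quadratic (F : R -> R) s d C :
  (forall h, `|h| <= 1 -> `|F (s + h) - F s - h * d| <= C * h ^+ 2) ->
  is_derive s 1 F d.
Proof.
move=> H.
have C0 : 0 <= C by have := H 1; rewrite normr1 expr1n mulr1 => /(_ (lexx _)); exact: le_trans.
have L : h^-1 *: ((F \o shift s) (h *: (1:R)) - F s) @[h --> 0^'] --> d.
  apply/cvgrPdist_le => e e0.
  have e1 : 0 < Num.min 1 (e / (C + 1)) by rewrite lt_min ltr01 divr_gt0// ltr_wpDl.
  near=> h.
  have h0 : h != 0 by near: h; exact: nbhs_dnbhs_neq.
  have : `|h| <= Num.min 1 (e / (C + 1)).
    near: h; apply: (@dnbhs0_le _ _ _) => //.
  rewrite le_min => /andP[h1]; rewrite ler_pdivlMr ?ltr_wpDl// => he.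
  rewrite /= (_ : h *: (1:R) = h); last by rewrite /GRing.scale /= mulr1.
  have nh : 0 < `|h| by rewrite normr_gt0.
  rewrite -(ler_pM2l nh).
  rewrite -normrM (_ : h * _ = - (F (s + h) - F s - h * d)); last first.
    by rewrite (addrC h s) /GRing.scale /=; field.
  rewrite normrN (le_trans (H h h1))//.
  rewrite -real_normK ?num_real// expr2 mulrCA ler_wpM2l// mulrC (le_trans _ he)//.
  by rewrite ler_wpM2l// lerDl.
by split; [apply/cvg_ex; exists d|exact/cvg_lim].
Unshelve. all: by end_near. Qed.

Lemma is_derive_pospart2 s :
  is_derive s 1 (fun t => pospart t ^+ 2) (2 * pospart s).
Proof.
apply: (@is_derive_quadratic _ _ _ 1) => h _; rewrite /pospart ler_norml.
by case: (leP s 0) => s0; case: (leP (s + h) 0) => sh; apply/andP; split; nra.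
Qed.

Lemma is_derive_pospart3 s :
  is_derive s 1 (fun t => pospart t ^+ 3) (3 * pospart s ^+ 2).
Proof.
(* On the positive side the remainder is 3 s h^2 + h^3, at most (3 s + 1) h^2 in absolute value for
   |h| <= 1. The larger constant also covers steps that cross 0. *)
apply: (@is_derive_quadratic _ _ _ (3 * pospart s + 3)) => h.
rewrite /pospart ler_norml => /andP[h1 h2]; rewrite ler_norml.
case: (leP s 0) => s0; case: (leP (s + h) 0) => sh; apply/andP; split.
- nra.
- nra.
- have : 0 <= (s + h) ^+ 3 by rewrite exprn_ge0// ltW.
  nra.
- have : (s + h) ^+ 3 <= h ^+ 3 by rewrite lerXn2r ?nnegrE; lra.
  have : h ^+ 3 <= h ^+ 2 by rewrite exprS; nra.
  nra.
- have h0 : h < 0 by lra.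
  have : s ^+ 2 <= h ^+ 2 by nra.
  nra.
- have h0 : h < 0 by lra.
  have : s ^+ 2 <= h ^+ 2 by nra.
  nra.
- nra.
- nra.
Qed.

(* [bump2] is the hat function of mass 1 on [0, 1]; [bump1] and [bump0] are its
   successive antiderivatives. *)
Definition bump0 s : R := 2 / 3 * (pospart s ^+ 3
  - 2 * pospart (s - 1 / 2) ^+ 3 + pospart (s - 1) ^+ 3).
Definition bump1 s : R := 2 * (pospart s ^+ 2
  - 2 * pospart (s - 1 / 2) ^+ 2 + pospart (s - 1) ^+ 2).
Definition bump2 s : R := 4 * (pospart s
  - 2 * pospart (s - 1 / 2) + pospart (s - 1)).

Lemma is_derive_shiftl (F : R -> R) s c d :
  is_derive (s - c) 1 F d -> is_derive s 1 (fun t => F (t - c)) d.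
Proof. by apply: is_derive_congr => h; rewrite addrA. Qed.

Lemma is_derive_bump0 s : is_derive s 1 bump0 (bump1 s).
Proof.
have H1 := is_derive_pospart3 s.
have H2 := @is_derive_shiftl _ s _ _ (is_derive_pospart3 (s - 1/2)).
have H3 := @is_derive_shiftl _ s _ _ (is_derive_pospart3 (s - 1)).
apply: (is_derive_ext (is_deriveZ (2/3) (is_deriveD (is_deriveB H1 (is_deriveZ 2 H2)) H3))) => //.
by rewrite /bump1 /GRing.scale /=; field.
Qed.

Lemma is_derive_bump1 s : is_derive s 1 bump1 (bump2 s).
Proof.
have H1 := is_derive_pospart2 s.
have H2 := @is_derive_shiftl _ s _ _ (is_derive_pospart2 (s - 1/2)).
have H3 := @is_derive_shiftl _ s _ _ (is_derive_pospart2 (s - 1)).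
apply: (is_derive_ext (is_deriveZ 2 (is_deriveD (is_deriveB H1 (is_deriveZ 2 H2)) H3))) => //.
by rewrite /bump2 /GRing.scale /=; ring.
Qed.

Lemma continuous_pospart : continuous pospart.
Proof.
move=> s; apply: (@continuous_max _ _ id (cst 0)); first exact: cvg_id.
exact: cvg_cst.
Qed.

Lemma continuous_bump2 : continuous bump2.
Proof.
have H c : continuous (fun s : R => pospart (s - c)).
  move=> s; apply: (@continuous_comp _ _ _ (fun s => s - c) pospart).
    by apply: cvgB; [exact: cvg_id|exact: cvg_cst].
  exact: continuous_pospart.
move=> s; apply: cvgM; first exact: cvg_cst.
apply: cvgD; last exact: H.
apply: cvgB; first exact: continuous_pospart.
by apply: cvgM; [exact: cvg_cst|exact: H].
Qed.

Lemma pospart_cases s : (s <= 0 /\ pospart s = 0) \/ (0 < s /\ pospart s = s).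
Proof. by rewrite /pospart; case: leP; [left|right]. Qed.

Lemma bump_le0 s : s <= 0 -> [/\ bump0 s = 0, bump1 s = 0 & bump2 s = 0].
Proof.
rewrite /bump0 /bump1 /bump2 => s0.
have [[_ ->]|[]] := pospart_cases s; last lra.
have [[_ ->]|[]] := pospart_cases (s - 1/2); last lra.
have [[_ ->]|[]] := pospart_cases (s - 1); last lra.
by split; ring.
Qed.

Lemma bump_ge1 s : 1 <= s ->
  [/\ bump0 s = s - 1 / 2, bump1 s = 1 & bump2 s = 0].
Proof.
rewrite /bump0 /bump1 /bump2 => s0.
have [[]|[_ ->]] := pospart_cases s; first lra.
have [[]|[_ ->]] := pospart_cases (s - 1/2); first lra.
have -> : pospart (s - 1) = s - 1 by have [[? ->]|[_ ->]] := pospart_cases (s - 1); lra.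
by split; field.
Qed.

Lemma bump_bounds s :
  [/\ 0 <= bump0 s, bump0 s <= pospart s, 0 <= bump1 s, bump1 s <= 1 & 0 <= bump2 s].
Proof.
have [s0|s0] := leP s 0.
  have [-> -> ->] := bump_le0 _ s0.
  by have [[? ->]|[? ->]] := pospart_cases s; split; lra.
have [s1|s1] := leP 1 s.
  have [-> -> ->] := bump_ge1 _ s1.
  by have [[? ->]|[? ->]] := pospart_cases s; split; lra.
rewrite /bump0 /bump1 /bump2.
have [[]|[_ ->]] := pospart_cases s; first lra.
have [[_ ->]|[]] := pospart_cases (s - 1); last lra.
have [[? ->]|[? ->]] := pospart_cases (s - 1/2).
  by split; rewrite ?(expr0n, mulr0, subr0, addr0) //=; nra.
(* On (1/2, 1) the polynomials are expanded about the knot 1/2, with t between 0 and 1/2. *)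
have E : s = (s - 1/2) + 1/2 by ring.
move: E; set t := s - 1/2 => E; rewrite E; have t2 : t < 1/2 by lra.
split.
- have -> : (t + 1 / 2) ^+ 3 - 2 * t ^+ 3 + 0 ^+ 3 =
    t * (1/4 - t^+2) + 3/2 * t^+2 + t/2 + 1/8 by field.
  have : t ^+ 2 <= 1/4 by nra.
  nra.
- have -> : (t + 1 / 2) ^+ 3 - 2 * t ^+ 3 + 0 ^+ 3 =
    - t^+3 + 3/2 * t^+2 + 3/4 * t + 1/8 by field.
  have : 0 <= t ^+ 3 by rewrite exprn_ge0// ltW.
  nra.
- nra.
- nra.
- nra.
Qed.

(** These are eta of the overview, eta' and eta''. The rescaling puts the mass of eta'' on [e, 2e],
    and eta(s) = s - 3e/2 for s >= 2e. *)
Definition cutoff0 (e : R) s := e * bump0 (s / e - 1).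
Definition cutoff1 (e : R) s := bump1 (s / e - 1).
Definition cutoff2 (e : R) s := bump2 (s / e - 1) / e.

Lemma is_derive_scale_shift (F : R -> R) (e s d : R) :
  is_derive (s / e - 1) 1 F d -> is_derive s 1 (fun t => F (t / e - 1)) (d / e).
Proof.
move=> H.
have G : is_derive s 1 (fun t : R => t / e - 1) e^-1.
  apply: (is_derive_ext (is_deriveB (is_deriveZ e^-1 (is_derive_id s (1:R)))
      (is_derive_cst (1:R) s (1:R)))) => [t|].
    by rewrite !fctE /GRing.scale /= mulrC.
  by rewrite subr0 /GRing.scale /= mulr1.
have := @is_derive1_comp _ F (fun t : R => t / e - 1) s _ _ H G.
by rewrite /GRing.scale.
Qed.

Lemma is_derive_cutoff0 (e s : R) : e != 0 ->
  is_derive s 1 (cutoff0 e) (cutoff1 e s).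
Proof.
move=> e0.
apply: (is_derive_ext (is_deriveZ e (is_derive_scale_shift _ e s _
  (is_derive_bump0 (s / e - 1))))) => //.
by rewrite /GRing.scale /= /cutoff1 mulrC divfK.
Qed.

Lemma is_derive_cutoff1 (e s : R) : is_derive s 1 (cutoff1 e) (cutoff2 e s).
Proof. exact: (is_derive_scale_shift _ e s _ (is_derive_bump1 (s / e - 1))). Qed.

Lemma continuous_cutoff2 (e : R) : continuous (cutoff2 e).
Proof.
move=> s; apply: cvgM; last exact: cvg_cst.
apply: (@continuous_comp _ _ _ (fun s => s / e - 1) bump2); last exact: continuous_bump2.
apply: cvgB; last exact: cvg_cst.
by apply: cvgM; [exact: cvg_id|exact: cvg_cst].
Qed.

Lemma cutoff_le e s : 0 < e -> s <= e ->
  [/\ cutoff0 e s = 0, cutoff1 e s = 0 & cutoff2 e s = 0].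
Proof.
move=> e0 se; have : s / e - 1 <= 0 by rewrite subr_le0 ler_pdivrMr// mul1r.
by rewrite /cutoff0 /cutoff1 /cutoff2 => /bump_le0[-> -> ->]; rewrite mulr0 mul0r.
Qed.

Lemma cutoff2_ge e s : 0 < e -> 2 * e <= s -> cutoff2 e s = 0.
Proof.
move=> e0 se; have : 1 <= s / e - 1 by rewrite lerBrDr ler_pdivlMr// -natr1 in se *; lra.
by rewrite /cutoff2 => /bump_ge1[_ _ ->]; rewrite mul0r.
Qed.

(** The last bound says that eta is homogeneous of degree one up to 2e. It allows eta'(phi) phi,
    which comes from the eigenvalue equation, to be replaced by the weight eta(phi). *)
Lemma cutoff_bounds e s : 0 < e -> 0 <= s ->
  [/\ 0 <= cutoff0 e s <= s, s - 2 * e <= cutoff0 e s,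
      0 <= cutoff1 e s <= 1, 0 <= cutoff2 e s &
      `|cutoff1 e s * s - cutoff0 e s| <= 2 * e].
Proof.
move=> e0; rewrite /cutoff0 /cutoff1 /cutoff2.
set t := s / e - 1 => s0.
have E : s = e * (t + 1) by rewrite /t subrK mulrC divfK ?gt_eqF.
have t1 : -1 <= t by rewrite E in s0; have := divr_ge0 s0 (ltW e0); rewrite -E /t; lra.
have [b0 b0' b1 b1' b2] := bump_bounds t.
have b2e : 0 <= bump2 t / e by rewrite divr_ge0// ltW.
have pt : pospart t <= t + 1 by have [[? ->]|[? ->]] := pospart_cases t; lra.
have [tle|tge] := leP t 1.
  rewrite ler_norml E; split=> //; try (apply/andP; split); nra.
have [/[dup] e0' -> /[dup] e1' -> _] := bump_ge1 _ (ltW tge).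
by rewrite ler_norml E; split=> //; try (apply/andP; split); nra.
Qed.

End profile.

(** * Green's identity for a cut-off weight *)

Section zero_extension.
Context {R : realType}.

Lemma patch_eq_in {T : Type} (A : set T) (G : T -> R) x : A x -> (G \_ A) x = G x.
Proof. by move=> Ax; rewrite patchE mem_set. Qed.

Lemma patch_eq_out {T : Type} (A : set T) (G : T -> R) x : ~ A x -> (G \_ A) x = 0.
Proof. by move=> Ax; rewrite patchE memNset. Qed.

(** [A] and the complement of [K] are open and cover the space; the extension agrees with [G] on the
    first and vanishes on the second. The same covering gives the derivatives in
    [is_derive_patch]. *)
Lemma continuous_patch {T : topologicalType} {A K : set T} {G : T -> R} :
  open A -> closed K -> K `<=` A -> (forall x, A x -> {for x, continuous G}) ->
  (forall x, A x -> ~ K x -> G x = 0) -> continuous (G \_ A).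
Proof.
move=> oA cK KA cG G0 x; have [Ax|nAx] := pselect (A x).
  rewrite /continuous_at patch_eq_in//; apply: cvg_trans (cG x Ax).
  apply: near_eq_cvg; have : nbhs x A by exact: open_nbhs_nbhs.
  by apply: filterS => y Ay; rewrite patch_eq_in.
rewrite /continuous_at patch_eq_out//.
have E : \near x, 0 = (G \_ A) x.
  have : nbhs x (~` K).
    by apply: open_nbhs_nbhs; split; [exact: closed_openC|move=> /KA].
  apply: filterS => y Ky; have [Ay|nAy] := pselect (A y).
    by rewrite patch_eq_in// G0.
  by rewrite patch_eq_out.
exact: cvg_trans (near_eq_cvg E) (cvg_cst (0 : R)).
Qed.

Lemma continuous_at_sum (T : topologicalType) I (r : seq I) (F : I -> T -> R) x :
  (forall i, {for x, continuous (F i)}) ->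
  {for x, continuous (fun y => \sum_(i <- r) F i y)}.
Proof.
move=> cF; elim: r => [|i r IH].
  rewrite (_ : (fun _ => _) = cst 0); first exact: cvg_cst.
  by apply/funext => y; rewrite big_nil.
rewrite (_ : (fun _ => _) = (fun y => F i y + \sum_(j <- r) F j y)).
  by apply: cvgD; [exact: cF|exact: IH].
by apply/funext => y; rewrite big_cons.
Qed.

Lemma is_derive_patch {V : normedModType R} {A K : set V} {G dG : V -> R} {v} :
  open A -> closed K -> K `<=` A -> (forall x, A x -> is_derive x v G (dG x)) ->
  (forall x, A x -> ~ K x -> G x = 0) ->
  forall x, is_derive x v (G \_ A) ((dG \_ A) x).
Proof.
move=> oA cK KA dGG G0 x; have [Ax|nAx] := pselect (A x).
  rewrite (patch_eq_in _ dG)//; apply: near_eq_is_derive (dGG x Ax).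
  have : nbhs x A by exact: open_nbhs_nbhs.
  by apply: filterS => y Ay; rewrite patch_eq_in.
rewrite (patch_eq_out _ dG)//.
apply: near_eq_is_derive (is_derive_cst (0 : R) x v).
have : nbhs x (~` K).
  by apply: open_nbhs_nbhs; split; [exact: closed_openC|move=> /KA].
apply: filterS => y Ky; have [Ay|nAy] := pselect (A y).
  by rewrite patch_eq_in// G0.
by rewrite patch_eq_out.
Qed.

(** Restricting f to the line through x with direction v reduces this to the chain rule in one
    variable, so no total differentiability of f is involved. *)
Lemma is_derive_comp_dir {V : normedModType R} {f : V -> R} {h : R -> R} {x v df dh} :
  is_derive x v f df -> is_derive (f x) 1 h dh ->
  is_derive x v (h \o f) (dh * df).
Proof.
move=> Df Dh.
have Dl : is_derive (0 : R) 1 (fun t : R => f (t *: v + x)) df.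
  apply: is_derive_congr Df => t; congr (f (_ *: v + x)).
  by rewrite addr0 /GRing.scale /= mulr1.
have Dh' : is_derive ((fun t : R => f (t *: v + x)) 0) 1 h dh.
  by rewrite scale0r add0r.
have := is_derive1_comp Dh' Dl.
apply: is_derive_congr => t /=.
by rewrite addr0 /GRing.scale /= mulr1.
Qed.

Lemma bounded_set_norm (V : normedModType R) (A : set V) : bounded_set A ->
  exists2 B : R, 0 < B & forall x, A x -> `|x| < B.
Proof.
move=> [M [_ MA]]; exists (`|M| + 2); first by rewrite ltr_wpDl.
move=> x Ax; apply: (@le_lt_trans _ _ (`|M| + 1)); last by rewrite ltrD2l ltr1n.
by apply: MA => //; rewrite (le_lt_trans (ler_norm _))// ltrDl.
Qed.

Lemma lebesgue_rV_bounded_lty n (A : set 'rV[R]_n) : open A -> bounded_set A ->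
  (lebesgue_rV R n A < +oo)%E.
Proof.
move=> oA /bounded_set_norm[B B0 AB].
apply: le_lt_trans (lebesgue_rV_ball_lty n B (ltW B0)).
apply: le_measure; rewrite ?inE.
- exact: open_measurable_rV.
- exact: measurable_norm_le.
- by move=> x /AB/ltW.
Qed.

Lemma integrable_bounded_open n (A : set 'rV[R]_n) (G : 'rV[R]_n -> R) (M : R) :
  open A -> bounded_set A -> (forall x, A x -> {for x, continuous G}) ->
  (forall x, A x -> `|G x| <= M) ->
  (lebesgue_rV R n).-integrable A (EFin \o G).
Proof.
move=> oA bA cG GM; apply: measurable_bounded_integrable.
- exact: open_measurable_rV.
- exact: lebesgue_rV_bounded_lty.
- exact: continuous_measurable_rV.
- exists M; split; first exact: num_real.
  by move=> y My x Ax /=; rewrite (le_trans (GM x Ax))// ltW.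
Qed.

Lemma integrable_compact_support n (A K : set 'rV[R]_n) (G : 'rV[R]_n -> R) :
  open A -> bounded_set A -> closed K -> K `<=` A ->
  (forall x, A x -> {for x, continuous G}) ->
  (forall x, A x -> ~ K x -> G x = 0) ->
  (lebesgue_rV R n).-integrable A (EFin \o G).
Proof.
move=> oA bA cK KA cG G0.
have cGA := continuous_patch oA cK KA cG G0.
have [B B0 AB] := bounded_set_norm _ _ bA.
have [M HM] : exists M : R, forall x, `|(G \_ A) x| <= M.
  apply: (bounded_continuous_support _ _ B) => // x Bx.
  by rewrite patch_eq_out// => /AB; rewrite ltNge Bx.
apply: (integrable_bounded_open _ _ _ M) => // x Ax.
by rewrite -(patch_eq_in _ G x Ax).
Qed.

End zero_extension.

(** * Integration by parts against a function of phi *)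

Section green.
Context {R : realType} (n : nat).
Implicit Types (Omega K : set 'rV[R]_n) (phi w : 'rV[R]_n -> R).

Definition sqnorm_grad phi (x : 'rV[R]_n) : R := \sum_(i < n) partial i phi x ^+ 2.

Lemma continuous_laplacian Omega w : C2_on Omega w ->
  forall x, Omega x -> {for x, continuous (laplacian w)}.
Proof.
move=> Cw x Ox; apply: continuous_at_sum => i; exact: (C2_cont_partial2 Cw).
Qed.

Lemma continuous_sqnorm_grad Omega w : C2_on Omega w ->
  forall x, Omega x -> {for x, continuous (sqnorm_grad w)}.
Proof.
move=> Cw x Ox; apply: continuous_at_sum => i.
apply: (@continuous_comp _ _ _ (partial i w) (fun s => s ^+ 2)).
  exact: (C2_cont_partial Cw).
exact: exprn_continuous.
Qed.

Lemma continuous_of_is_derive (h h1 : R -> R) :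
  (forall s : R, is_derive s 1 h (h1 s)) -> continuous h.
Proof.
by move=> H s; apply/differentiable_continuous/derivable1_diffP; case: (H s).
Qed.

(** The vector field h(phi) grad w - w grad h(phi) vanishes off [K], and its divergence is the
    difference of the two integrands. Each component contributes a partial derivative with integral
    zero. *)
Lemma green_cutoff Omega K phi w (h h1 h2 : R -> R) :
  open Omega -> bounded_set Omega -> closed K -> K `<=` Omega ->
  C2_on Omega phi -> C2_on Omega w ->
  (forall s : R, is_derive s 1 h (h1 s)) -> (forall s : R, is_derive s 1 h1 (h2 s)) ->
  continuous h2 ->
  (forall x, Omega x -> ~ K x -> [/\ h (phi x) = 0, h1 (phi x) = 0 & h2 (phi x) = 0]) ->
  \int[lebesgue_rV R n]_(x in Omega) (h (phi x) * laplacian w x) =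
  \int[lebesgue_rV R n]_(x in Omega)
     (w x * (h2 (phi x) * sqnorm_grad phi x + h1 (phi x) * laplacian phi x)).
Proof.
move=> oO bO cK KO Cphi Cw Dh Dh1 ch2 h0.
have ch := continuous_of_is_derive _ _ Dh.
have ch1 := continuous_of_is_derive _ _ Dh1.
have mO := open_measurable_rV _ _ oO.
have cphi x : Omega x -> {for x, continuous phi} by exact: C2_cont.
have cw x : Omega x -> {for x, continuous w} by exact: C2_cont.
have chphi (k : R -> R) x : continuous k -> Omega x -> {for x, continuous (k \o phi)}.
  by move=> ck Ox; apply: continuous_comp; [exact: cphi|exact: ck].
(* [W i] is the i-th component of the field and [D i] its i-th partial derivative; in the latter the
   mixed terms h1(phi) (d_i phi)(d_i w) have cancelled. *)
pose W i x := h (phi x) * partial i w x - w x * (h1 (phi x) * partial i phi x).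
pose D i x := h (phi x) * partial i (partial i w) x -
  w x * (h2 (phi x) * partial i phi x ^+ 2 + h1 (phi x) * partial i (partial i phi) x).
have alg (a b c d e f k q : R) : a * b + c * (d * e) -
    (f * (d * k + e * (q * e)) + d * e * c) = a * b - f * (q * e ^+ 2 + d * k).
  by ring.
have alg0 (a b c d : R) : 0 * a - b * (0 * c + 0 * d) = 0 by ring.
have DW i x : Omega x -> is_derive x (delta_mx 0 i) (W i) (D i x).
  move=> Ox.
  have dphi : is_derive x (delta_mx 0 i) phi (partial i phi x).
    by apply: DeriveDef => //; exact: (C2_derivable Cphi).
  have dw : is_derive x (delta_mx 0 i) w (partial i w x).
    by apply: DeriveDef => //; exact: (C2_derivable Cw).
  have ddphi : is_derive x (delta_mx 0 i) (partial i phi) (partial i (partial i phi) x).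
    by apply: DeriveDef => //; exact: (C2_derivable2 Cphi).
  have ddw : is_derive x (delta_mx 0 i) (partial i w) (partial i (partial i w) x).
    by apply: DeriveDef => //; exact: (C2_derivable2 Cw).
  have dh := is_derive_comp_dir dphi (Dh (phi x)).
  have dh1 := is_derive_comp_dir dphi (Dh1 (phi x)).
  apply: (is_derive_ext
    (is_deriveB (is_deriveM dh ddw) (is_deriveM dw (is_deriveM dh1 ddphi)))) => //.
  rewrite /D (_ : ((h1 \o phi) * partial i phi) x = h1 (phi x) * partial i phi x)//.
  exact: alg.
have cD i x : Omega x -> {for x, continuous (D i)}.
  move=> Ox.
  have c1 := chphi h x ch Ox.
  have c2 : {for x, continuous (partial i (partial i w))} by exact: (C2_cont_partial2 Cw).
  have c3 := chphi h2 x ch2 Ox.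
  have c4 : {for x, continuous (fun y => partial i phi y ^+ 2)}.
    apply: (@continuous_comp _ _ _ (partial i phi) (fun s => s ^+ 2)).
      exact: (C2_cont_partial Cphi).
    exact: exprn_continuous.
  have c5 := chphi h1 x ch1 Ox.
  have c6 : {for x, continuous (partial i (partial i phi))}.
    exact: (C2_cont_partial2 Cphi).
  exact: (cvgB (cvgM c1 c2) (cvgM (cw x Ox) (cvgD (cvgM c3 c4) (cvgM c5 c6)))).
have W0 i x : Omega x -> ~ K x -> W i x = 0.
  by move=> Ox Kx; have [h0x h1x _] := h0 x Ox Kx; rewrite /W h0x h1x !mul0r mulr0 subr0.
have D0 i x : Omega x -> ~ K x -> D i x = 0.
  move=> Ox Kx; have [h0x h1x h2x] := h0 x Ox Kx.
  by rewrite /D h0x h1x h2x; exact: alg0.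
have iD i : (lebesgue_rV R n).-integrable Omega (EFin \o D i).
  exact: (integrable_compact_support _ _ K _ oO bO cK KO (cD i) (D0 i)).
have [B B0 OB] := bounded_set_norm _ _ bO.
have ID i : (\int[lebesgue_rV R n]_(x in Omega) (D i x)%:E = 0)%E.
  rewrite integral_mkcond restrict_EFin.
  apply: (integral_partial_eq0 _ i (W i \_ Omega) _ B) => //.
  - exact: (is_derive_patch oO cK KO (DW i) (W0 i)).
  - exact: (continuous_patch oO cK KO (cD i) (D0 i)).
  - by move=> x Bx; rewrite patch_eq_out// => /OB; rewrite ltNge Bx.
  - by move=> x Bx; rewrite patch_eq_out// => /OB; rewrite ltNge Bx.
apply/eqP; rewrite -subr_eq0 -RintegralB//; last 2 first.
- apply: (integrable_compact_support _ _ K) => // x Ox.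
    exact: (cvgM (chphi h x ch Ox) (continuous_laplacian _ _ Cw x Ox)).
  by move=> Kx; have [-> _ _] := h0 x Ox Kx; rewrite mul0r.
- apply: (integrable_compact_support _ _ K) => // x Ox.
    exact: (cvgM (cw x Ox) (cvgD
      (cvgM (chphi h2 x ch2 Ox) (continuous_sqnorm_grad _ _ Cphi x Ox))
      (cvgM (chphi h1 x ch1 Ox) (continuous_laplacian _ _ Cphi x Ox)))).
  by move=> Kx; have [_ -> ->] := h0 x Ox Kx; rewrite !mul0r addr0 mulr0.
rewrite /Rintegral.
under eq_integral => x _.
  rewrite (_ : _ - _ = \sum_(i < n) D i x); last first.
    rewrite /laplacian /sqnorm_grad !mulr_sumr -big_split mulr_sumr -sumrB.
    by apply: eq_bigr.
  rewrite -sumEFin.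
  over.
by rewrite integral_sum// big1.
Qed.

End green.

(** * Weighted averages of a solution *)

(** Continuity relative to [C], with zero values on [C] outside [A], becomes continuity in the whole
    space. With [C] built from the closure of Omega, this turns the Dirichlet condition into
    continuity of the zero extension. *)
Lemma continuous_patch_boundary {R : realType} (T : topologicalType)
    (A C : set T) (F : T -> R) x :
  open A -> A `<=` C -> {within C, continuous F} ->
  (forall y, C y -> ~ A y -> F y = 0) -> C x \/ nbhs x (~` C) ->
  {for x, continuous (F \_ A)}.
Proof.
move=> oA AC /subspace_continuousP cF F0 Cx.
have E y : C y -> (F \_ A) y = F y.
  move=> Cy; have [Ay|nAy] := pselect (A y); first by rewrite patch_eq_in.
  by rewrite patch_eq_out// F0.
case: Cx => [Cx|nCx].
  rewrite /prop_for /continuous_at E// => V nV.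
  have : within C (nbhs x) (F @^-1` V) by exact: (cF x Cx V nV).
  rewrite /within /=.
  have [Ax|nAx] := pselect (A x).
    have : nbhs x A by exact: open_nbhs_nbhs.
    apply: filterS2 => y Ay /(_ (AC _ Ay)) /=; by rewrite patch_eq_in.
  apply: filterS => y VF /=; have [Ay|nAy] := pselect (A y).
    by rewrite patch_eq_in//; apply: VF; exact: AC.
  rewrite patch_eq_out//; have := nbhs_singleton nV.
  by rewrite F0.
have E0 : \near x, 0 = (F \_ A) x.
  by apply: filterS nCx => y nCy; rewrite patch_eq_out// => /AC.
have -> : {for x, continuous (F \_ A)} = ((F \_ A) y @[y --> x] --> (0 : R)).
  by rewrite /prop_for /continuous_at (patch_eq_out _ _ x)// => /AC; exact: (nbhs_singleton nCx).
exact: cvg_trans (near_eq_cvg E0) (cvg_cst (0 : R)).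
Qed.

Lemma open_time_interval {R : realType} (T : \bar R) : open (time_interval T).
Proof.
case: T => [r||].
- rewrite (_ : time_interval _ = `]0, r[%classic); first exact: interval_open.
  by apply/seteqP; split => t; rewrite /time_interval /= in_itv /= lte_fin => /andP.
- rewrite (_ : time_interval _ = `]0, +oo[%classic); first exact: interval_open.
  apply/seteqP; split => t; rewrite /time_interval /= in_itv /= andbT; first by case.
  by split => //; exact: ltry.
- rewrite (_ : time_interval _ = set0); first exact: open0.
  by apply/seteqP; split => t //= [_]; rewrite ltNge leNye.
Qed.

(** * Bounded continuous integrands on a bounded open set *)

Section bounded_continuous.
Context {R : realType} (n : nat) (Omega : set 'rV[R]_n).
Hypotheses (oO : open Omega) (bO : bounded_set Omega).
Implicit Types G : 'rV[R]_n -> R.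

(** A class stable under sums and products and contained in the integrable functions; membership
    settles the integrability conditions met in handling the weighted averages. *)
Definition bounded_continuous G :=
  (forall x, Omega x -> {for x, continuous G}) /\
  exists M : R, forall x, Omega x -> `|G x| <= M.

Lemma bounded_continuous_integrable G : bounded_continuous G ->
  (lebesgue_rV R n).-integrable Omega (EFin \o G).
Proof. by move=> [cG [M GM]]; exact: (integrable_bounded_open _ _ _ M). Qed.

Lemma bounded_continuous_cst (c : R) : bounded_continuous (fun=> c).
Proof. by split; [move=> x _; exact: cst_continuous|exists `|c|]. Qed.

Lemma bounded_continuousD G1 G2 : bounded_continuous G1 -> bounded_continuous G2 ->
  bounded_continuous (fun x => G1 x + G2 x).
Proof.
move=> [c1 [M1 B1]] [c2 [M2 B2]]; split.
  by move=> x Ox; exact: (cvgD (c1 x Ox) (c2 x Ox)).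
by exists (M1 + M2) => x Ox; rewrite (le_trans (ler_normD _ _))// lerD ?B1 ?B2.
Qed.

Lemma bounded_continuousM G1 G2 : bounded_continuous G1 -> bounded_continuous G2 ->
  bounded_continuous (fun x => G1 x * G2 x).
Proof.
move=> [c1 [M1 B1]] [c2 [M2 B2]]; split.
  by move=> x Ox; exact: (cvgM (c1 x Ox) (c2 x Ox)).
by exists (M1 * M2) => x Ox; rewrite normrM ler_pM ?B1 ?B2.
Qed.

Lemma bounded_continuous_support_in (K : set 'rV[R]_n) G : closed K -> K `<=` Omega ->
  (forall x, Omega x -> {for x, continuous G}) ->
  (forall x, Omega x -> ~ K x -> G x = 0) -> bounded_continuous G.
Proof.
move=> cK KO cG G0; split=> //.
have [B B0 OB] := bounded_set_norm _ _ bO.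
have [M HM] : exists M : R, forall x, `|(G \_ Omega) x| <= M.
  apply: (bounded_continuous_support _ _ B).
    exact: (continuous_patch (K := K)).
  by move=> x Bx; rewrite patch_eq_out// => /OB; rewrite ltNge Bx.
by exists M => x Ox; rewrite -(patch_eq_in _ G x Ox).
Qed.

Lemma Rintegral_linear G1 G2 (c : R) : bounded_continuous G1 -> bounded_continuous G2 ->
  \int[lebesgue_rV R n]_(x in Omega) (c * G1 x + G2 x) =
  c * \int[lebesgue_rV R n]_(x in Omega) G1 x + \int[lebesgue_rV R n]_(x in Omega) G2 x.
Proof.
move=> b1 b2; have mO := open_measurable_rV _ _ oO.
have bc := bounded_continuousM _ _ (bounded_continuous_cst c) b1.
rewrite RintegralD//; [|exact: bounded_continuous_integrable..].
by rewrite RintegralZl//; exact: bounded_continuous_integrable.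
Qed.

Lemma le_Rintegral_bounded_continuous G1 G2 :
  bounded_continuous G1 -> bounded_continuous G2 ->
  (forall x, Omega x -> G1 x <= G2 x) ->
  \int[lebesgue_rV R n]_(x in Omega) G1 x <= \int[lebesgue_rV R n]_(x in Omega) G2 x.
Proof.
move=> b1 b2; apply: le_Rintegral; first exact: open_measurable_rV.
- exact: bounded_continuous_integrable.
- exact: bounded_continuous_integrable.
Qed.

End bounded_continuous.

Lemma C2_on_cst {R : realType} (n : nat) (Omega : set 'rV[R]_n) (c : R) :
  C2_on Omega (fun=> c) /\ laplacian (fun _ : 'rV[R]_n => c) = fun=> 0.
Proof.
have P d i : @partial R n i (fun=> d) = fun=> 0.
  by apply/funext => x; rewrite /partial derive_cst.
split; last by apply/funext => x; rewrite /laplacian big1// => i _; rewrite !P.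
split => [x _|i x _|i x _|i j x _|i j x _]; rewrite ?P.
- exact: cst_continuous.
- exact: derivable_cst.
- exact: cst_continuous.
- exact: derivable_cst.
- exact: cst_continuous.
Qed.

(** * A solution on a compact time window *)

Section solution_on_window.
Context {R : realType} (n : nat) (Omega : set 'rV[R]_n) (phi : 'rV[R]_n -> R)
  (I : set R) (u : 'rV[R]_n -> R -> R) (a b : R).
Hypotheses (oO : open Omega) (bO : bounded_set Omega) (neO : Omega !=set0)
  (wphi : {within closure Omega, continuous phi})
  (phi0 : forall x, boundary Omega x -> phi x = 0)
  (phi_gt0 : forall x, Omega x -> 0 < phi x)
  (oI : open I) (Cu : C21_on Omega I u)
  (wu : {within closure Omega `*` I, continuous (fun p : 'rV[R]_n * R => u p.1 p.2)})
  (u_bnd : forall x t, boundary Omega x -> I t -> u x t = 0)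
  (ab : a < b) (abI : forall t, a <= t <= b -> I t).

Lemma boundary_open x : closure Omega x -> ~ Omega x -> boundary Omega x.
Proof. by move=> cx nOx; split => // /interior_subset. Qed.

Lemma compact_closure_bounded : compact (closure Omega).
Proof.
have [B B0 OB] := bounded_set_norm _ _ bO.
apply: bounded_closed_compact; last exact: closed_closure.
exists B; split; first exact: num_real.
move=> y By x cx; suff : `|x| <= B by move/le_trans; apply; exact: ltW.
have : closure [set x : 'rV[R]_n | `|x| <= B] x.
  by apply: closure_subset cx => z /OB /ltW.
by rewrite -(closure_id _).1//; exact: closed_norm_le.
Qed.

Lemma continuous_phi_patch : continuous (phi \_ Omega).
Proof.
move=> x; apply: (continuous_patch_boundary _ _ (closure Omega)) => //.
- exact: subset_closure.
- by move=> y cy nOy; apply: phi0; exact: boundary_open.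
- have [?|?] := pselect (closure Omega x); [by left|right].
  by apply: open_nbhs_nbhs; split; [apply: closed_openC; exact: closed_closure|].
Qed.

(** Extending by zero in space makes u continuous at every (x, t) with t in [I], so extreme values
    can be taken over the compact set made of the closure of Omega and [a, b]. *)
Definition u_patch : 'rV[R]_n * R -> R :=
  (fun p : 'rV[R]_n * R => u p.1 p.2) \_ (Omega `*` I).

Lemma continuous_u_patch x t : I t -> {for (x, t), continuous u_patch}.
Proof.
move=> It; apply: (continuous_patch_boundary _ _ (closure Omega `*` I)) => //.
- rewrite openE => -[y s] [/= Oy Is]; exists (Omega, I) => //=.
  by split; apply: open_nbhs_nbhs.
- by move=> [y s] [/= Oy Is]; split => //; exact: subset_closure.
- move=> [y s] [/= cy Is] nOI; apply: u_bnd => //; apply: boundary_open => // Oy.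
  exact: nOI.
- have [?|nx] := pselect (closure Omega x); [by left|right].
  exists (~` closure Omega, setT) => /=.
    split; last exact: filterT.
    by apply: open_nbhs_nbhs; split; [apply: closed_openC; exact: closed_closure|].
  by move=> [y s] [/= ncy _] [].
Qed.

Lemma compact_window : compact (closure Omega `*` `[a, b]).
Proof. by apply: compact_setX; [exact: compact_closure_bounded|exact: segment_compact]. Qed.

Lemma window_nonempty : (closure Omega `*` `[a, b]) !=set0.
Proof.
have [x Ox] := neO; exists (x, a); split => /=; first exact: subset_closure.
by rewrite in_itv /= lexx ltW.
Qed.

Lemma phi_bounded : exists2 P : R, 0 <= P & forall x, Omega x -> `|phi x| <= P.
Proof.
have [B B0 OB] := bounded_set_norm _ _ bO.
have [P HP] : exists P : R, forall x, `|(phi \_ Omega) x| <= P.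
  apply: (bounded_continuous_support _ _ B continuous_phi_patch) => x Bx.
  by rewrite patch_eq_out// => /OB; rewrite ltNge Bx.
exists P => [|x Ox]; first exact: le_trans (normr_ge0 _) (HP 0).
by rewrite -(patch_eq_in _ phi x Ox).
Qed.

Lemma u_bounded :
  exists2 M : R, 0 <= M & forall x t, Omega x -> a <= t <= b -> `|u x t| <= M.
Proof.
have [|[y s] _ H] :=
  @compact_EVT_max _ _ (fun p => `|u_patch p|) _ window_nonempty compact_window.
  apply: continuous_in_subspaceT => -[x t]; rewrite inE => -[_ /=].
  rewrite in_itv /= => /abI It.
  apply: (@continuous_comp _ _ _ u_patch (fun r : R => `|r|)).
    exact: continuous_u_patch.
  exact: norm_continuous.
exists `|u_patch (y, s)| => // x t Ox tab.
have := H (x, t); rewrite {1}/u_patch patch_eq_in//=; last by split => //; exact: abI.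
by apply; rewrite inE; split => /=; [exact: subset_closure|rewrite in_itv].
Qed.

Lemma u_small k : 0 < k ->
  exists2 e : R, 0 < e & forall x t, Omega x -> a <= t <= b -> phi x <= e -> `|u x t| <= k.
Proof.
move=> k0.
(* [q] is positive on the compact window: where |u| >= k, the point lies in Omega. *)
pose q (p : 'rV[R]_n * R) : R := pospart (k - `|u_patch p|) + (phi \_ Omega) p.1.
have cq : {within closure Omega `*` `[a, b], continuous q}.
  apply: continuous_in_subspaceT => -[x t]; rewrite inE => -[_ /=].
  rewrite in_itv /= => /abI It.
  have c1 : {for (x, t), continuous (fun p => k - `|u_patch p|)}.
    apply: cvgB; first exact: cvg_cst.
    apply: (@continuous_comp _ _ _ u_patch (fun r : R => `|r|)).
      exact: continuous_u_patch.
    exact: norm_continuous.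
  have c2 : {for (x, t), continuous (fun p => pospart (k - `|u_patch p|))}.
    by apply: continuous_comp; [exact: c1|exact: continuous_pospart].
  have c3 : {for (x, t), continuous (fun p : 'rV[R]_n * R => (phi \_ Omega) p.1)}.
    by apply: continuous_comp; [exact: cvg_fst|exact: continuous_phi_patch].
  exact: (cvgD c2 c3).
have phi_ge0 x : 0 <= (phi \_ Omega) x.
  have [Ox|nOx] := pselect (Omega x); first by rewrite patch_eq_in// ltW// phi_gt0.
  by rewrite patch_eq_out.
have [[y s] + H] := @compact_EVT_min _ _ q _ window_nonempty compact_window cq.
rewrite inE => -[/= cy]; rewrite in_itv /= => sab.
have q0 : 0 < q (y, s).
  rewrite /q /=; have [[ku ->]|[ku ->]] := pospart_cases (k - `|u_patch (y, s)|); last first.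
    by rewrite ltr_wpDr.
  rewrite add0r; have [Oy|nOy] := pselect (Omega y).
    by rewrite patch_eq_in// phi_gt0.
  exfalso; move: ku; rewrite /u_patch patch_eq_out; last by case.
  by rewrite normr0 subr0 leNgt k0.
(* Where phi is at most half the minimum of [q], the other summand of [q] must be positive, which
   means |u| < k. *)
exists (q (y, s) / 2); first by rewrite divr_gt0.
move=> x t Ox tab px.
have : q (y, s) <= q (x, t).
  by apply: H; rewrite inE; split => /=; [exact: subset_closure|rewrite in_itv].
rewrite {2}/q /= patch_eq_in// /u_patch patch_eq_in/=; last by split => //; exact: abI.
by have [[ku ->]|[ku _]] := pospart_cases (k - `|u x t|) => qq; lra.
Qed.

Lemma C2_on_slice t : I t -> C2_on Omega (u ^~ t).
Proof.
move=> It.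
have S (F : 'rV[R]_n * R -> R) x : {for (x, t), continuous F} ->
    {for x, continuous (fun y => F (y, t))}.
  move=> cF; apply: (@continuous_comp _ _ _ (fun y => (y, t)) F) => //.
  move=> V [[P Q] [/= nP nQ] PQV]; apply: filterS nP => y Py; apply: PQV.
  by split => //=; exact: nbhs_singleton nQ.
split.
- by move=> x Ox; apply: (S (fun p => u p.1 p.2)); exact: (C21_cont Cu).
- by move=> i x Ox; exact: (C21_derivable_x Cu).
- by move=> i x Ox; apply: (S (fun p => partial i (u ^~ p.2) p.1)); exact: (C21_cont_x Cu).
- by move=> i j x Ox; exact: (C21_derivable_xx Cu).
- move=> i j x Ox; apply: (S (fun p => partial j (partial i (u ^~ p.2)) p.1)).
  exact: (C21_cont_xx Cu).
Qed.

(** The time derivative is controlled only on compact parts of Omega. That is enough, because the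
    weights are supported in such a part, and it provides the domination for differentiating under
    the integral. *)
Lemma ut_bounded (K : set 'rV[R]_n) : closed K -> K `<=` Omega ->
  exists2 M : R, 0 <= M & forall x t, K x -> a <= t <= b -> `|derive1 (u x) t| <= M.
Proof.
move=> cK KO.
have [K0|/set0P neK] := eqVneq K set0; first by exists 0 => // x t; rewrite K0.
have cKab : compact (K `*` `[a, b]).
  apply: compact_setX; last exact: segment_compact.
  apply: subclosed_compact cK compact_closure_bounded _.
  by move=> x /KO; exact: subset_closure.
have neKab : (K `*` `[a, b]) !=set0.
  by have [x Kx] := neK; exists (x, a); split => //=; rewrite in_itv /= lexx ltW.
have [|[y s] _ H] :=
  @compact_EVT_max _ _ (fun p : 'rV[R]_n * R => `|derive1 (u p.1) p.2|) _ neKab cKab.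
  apply: continuous_in_subspaceT => -[x t]; rewrite inE => -[/= /KO Ox].
  rewrite in_itv /= => /abI It.
  apply: (@continuous_comp _ _ _ (fun p : 'rV[R]_n * R => derive1 (u p.1) p.2)
    (fun r : R => `|r|)).
    exact: (C21_cont_t Cu).
  exact: norm_continuous.
exists `|derive1 (u y) s| => // x t Kx tab.
by apply: (H (x, t)); rewrite inE; split => //=; rewrite in_itv.
Qed.

(** [H] stands for 1/g, [H1] for its derivative and [c0] for lambda delta1; convexity of 1/g enters
    through the tangent inequality and the monotonicity of [H1]. *)
Context (mu1 c0 b1 : R) (H H1 : R -> R).
Hypotheses (Cphi : C2_on Omega phi) (mu1_gt0 : 0 < mu1)
  (eig : forall x, Omega x -> - laplacian phi x = mu1 * phi x)
  (phi_int : \int[lebesgue_rV R n]_(x in Omega) phi x = 1)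
  (c0_ge0 : 0 <= c0) (b1_ge0 : 0 <= b1) (b1_lt1 : b1 < 1)
  (H_ge0 : forall s, s < 1 -> 0 <= H s)
  (H1_ge0 : forall s, s < 1 -> 0 <= H1 s)
  (H_nd : forall s r, s <= r -> r < 1 -> H s <= H r)
  (H1_nd : forall s r, s <= r -> r < 1 -> H1 s <= H1 r)
  (H_tangent : forall s r, s < 1 -> r < 1 -> H s + H1 s * (r - s) <= H r)
  (u_ineq : forall x t, Omega x -> I t ->
    laplacian (u ^~ t) x + c0 * H (u x t) <= derive1 (u x) t)
  (u_le : forall x t, Omega x -> a <= t <= b -> u x t <= b1).

Local Notation "'avg' G" := (\int[lebesgue_rV R n]_(x in Omega) G x)
  (at level 10, G at level 8).

Let V : R := fine (lebesgue_rV R n Omega).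

Let V_ge0 : 0 <= V.
Proof. by rewrite /V fine_ge0. Qed.

Let mO : measurable Omega.
Proof. exact: open_measurable_rV. Qed.

Let phi_bc : bounded_continuous n Omega phi.
Proof. by split; [exact: C2_cont|have [P _ ?] := phi_bounded; exists P]. Qed.

(** * Averages at a fixed cutoff level *)

Section cutoff_window.
Variables (e M k : R).
Hypotheses (e_gt0 : 0 < e) (M_ge0 : 0 <= M) (k_ge0 : 0 <= k)
  (uM : forall x t, Omega x -> a <= t <= b -> `|u x t| <= M)
  (uk : forall x t, Omega x -> a <= t <= b -> phi x <= 2 * e -> `|u x t| <= k).

(** Using the zero extension of phi makes this set closed in the whole space and, as e > 0,
    contained in Omega. The weight vanishes off it. *)
Let K : set 'rV[R]_n := [set x | e <= (phi \_ Omega) x].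

Let cK : closed K.
Proof.
apply: (@preimage_closed _ _ (phi \_ Omega) [set y : R | e <= y]); last exact: closed_ge.
by move=> x _; exact: continuous_phi_patch.
Qed.

Let KO : K `<=` Omega.
Proof.
move=> x /=; rewrite /K /=; have [//|nOx] := pselect (Omega x).
by rewrite patch_eq_out// leNgt e_gt0.
Qed.

Let off_K x : Omega x -> ~ K x ->
  [/\ cutoff0 e (phi x) = 0, cutoff1 e (phi x) = 0 & cutoff2 e (phi x) = 0].
Proof.
move=> Ox; rewrite /K /= patch_eq_in// => /negP; rewrite -ltNge => /ltW.
exact: cutoff_le.
Qed.

Definition weight x := cutoff0 e (phi x).

Let cont_cut (h : R -> R) : continuous h ->
  forall x, Omega x -> {for x, continuous (h \o phi)}.
Proof.
by move=> ch x Ox; apply: continuous_comp; [exact: (C2_cont Cphi)|exact: ch].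
Qed.

Let e_neq0 : e != 0. Proof. by rewrite gt_eqF. Qed.

Let c_cut0 : continuous (cutoff0 e).
Proof. exact: (continuous_of_is_derive _ _ (fun s => is_derive_cutoff0 e s e_neq0)). Qed.

Let c_cut1 : continuous (cutoff1 e).
Proof. exact: (continuous_of_is_derive _ _ (is_derive_cutoff1 e)). Qed.

Let weight_bc (G : 'rV[R]_n -> R) : (forall x, Omega x -> {for x, continuous G}) ->
  bounded_continuous n Omega (fun x => G x * weight x).
Proof.
move=> cG; apply: (bounded_continuous_support_in _ _ oO bO K) => //.
  by move=> x Ox; exact: (cvgM (cG x Ox) (cont_cut _ c_cut0 x Ox)).
by move=> x Ox Kx; rewrite /weight; have [-> _ _] := off_K x Ox Kx; rewrite mulr0.
Qed.

Let w_bc : bounded_continuous n Omega weight.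
Proof.
apply: (bounded_continuous_support_in _ _ oO bO K) => //.
  by move=> x Ox; exact: (cont_cut _ c_cut0 x Ox).
by move=> x Ox Kx; rewrite /weight; have [-> _ _] := off_K x Ox Kx.
Qed.

Let u_cont t : I t -> forall x, Omega x -> {for x, continuous (u ^~ t)}.
Proof. by move=> It; apply: C2_cont; exact: C2_on_slice. Qed.

Definition wavg t := avg (fun x => u x t * weight x).
Definition dwavg t := avg (fun x => derive1 (u x) t * weight x).

Let ab_I t : a < t < b -> a <= t <= b.
Proof. by move=> /andP[/ltW-> /ltW->]. Qed.

Let abt_I t : a < t < b -> I t.
Proof. by move=> /ab_I /abI. Qed.

(** Differentiation under the integral with a constant as dominating function: on [K] the bound on
    u_t is used, and off [K] the weight vanishes. *)
Lemma is_derive_wavg t : a < t < b -> is_derive t 1 wavg (dwavg t).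
Proof.
move=> tab.
have tI : t \in `]a, b[ by rewrite in_itv.
have [N N0 HN] := ut_bounded K cK KO.
have [W HW] := w_bc.2.
have dE s x : Omega x -> I s ->
    is_derive s 1 (fun s => u x s * weight x) (derive1 (u x) s * weight x).
  move=> Ox Is; have du : is_derive s 1 (u x) (derive1 (u x) s).
    by rewrite derive1E; apply: DeriveDef => //; exact: (C21_derivable_t Cu).
  apply: (is_derive_ext (is_deriveM du (is_derive_cst (weight x) s 1))) => //.
  by rewrite /GRing.scale /= mulr0 add0r mulrC.
have intf s : `]a, b[%classic s ->
    (lebesgue_rV R n).-integrable Omega (EFin \o (fun x => u x s * weight x)).
  rewrite /= in_itv /= => /abt_I Is; apply: bounded_continuous_integrable => //.
  by apply: weight_bc; exact: u_cont.
have der s x : `]a, b[%classic s -> Omega x -> derivable (fun s => u x s * weight x) s 1.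
  by rewrite /= in_itv /= => /abt_I Is Ox; case: (dE s x Ox Is).
have G0 (x : 'rV[R]_n) : 0 <= N * `|W| by rewrite mulr_ge0.
have iG : (lebesgue_rV R n).-integrable Omega (EFin \o (fun=> N * `|W|)).
  by apply: bounded_continuous_integrable => //; exact: bounded_continuous_cst.
have Gub s x : `]a, b[%classic s -> Omega x ->
    `|partial1of2 (fun s x => u x s * weight x) s x| <= N * `|W|.
  rewrite /= in_itv /= => sab Ox; have [_ dd] := dE s x Ox (abt_I s sab).
  rewrite partial1of2E dd normrM.
  have [Kx|nKx] := pselect (K x).
    apply: ler_pM => //; first by apply: HN => //; exact: ab_I.
    by rewrite (le_trans (HW x Ox))// ler_norm.
  by rewrite /weight; have [-> _ _] := off_K x Ox nKx; rewrite normr0 mulr0; exact: (G0 x).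
split.
  exact: (@derivable_under_integral R _ _ (lebesgue_rV R n)
    (fun s x => u x s * weight x) Omega mO t a b tI intf der (fun=> N * `|W|) G0 iG Gub).
rewrite -derive1E.
have := @differentiation_under_integral R _ _ (lebesgue_rV R n)
  (fun s x => u x s * weight x) Omega mO t a b tI intf der (fun=> N * `|W|) G0 iG Gub.
move=> ->.
apply: eq_Rintegral => x; rewrite inE => Ox.
by have [_ dd] := dE t x Ox (abt_I t tab); rewrite partial1of2E dd.
Qed.

Let wb x (Ox : Omega x) := cutoff_bounds e (phi x) e_gt0 (ltW (phi_gt0 x Ox)).

(** Integrate s - 2e <= eta(s) <= s at s = phi(x); [V] is the volume of Omega. The mass is only
    close to 1, and this defect accounts for some of the error terms below. *)
Lemma weight_mass : 1 - 2 * e * V <= avg weight <= 1.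
Proof.
apply/andP; split; last first.
  rewrite -phi_int; apply: le_Rintegral_bounded_continuous => //.
  by move=> x Ox; have [/andP[]] := wb x Ox.
rewrite lerBlDr.
rewrite -[leLHS]phi_int -(Rintegral_cst (lebesgue_rV R n) mO) -[X in X + _]mul1r.
rewrite -Rintegral_linear//; last exact: bounded_continuous_cst.
apply: le_Rintegral_bounded_continuous => //.
  by apply: bounded_continuousD;
    [apply: bounded_continuousM => //; exact: bounded_continuous_cst|exact: bounded_continuous_cst].
by move=> x Ox; rewrite mul1r -lerBlDr; have [_ ] := wb x Ox.
Qed.

Lemma wavg_norm t : a < t < b -> `|wavg t| <= M.
Proof.
move=> tab; have bw := weight_bc _ (u_cont t (abt_I t tab)).
have [_ m1] := andP weight_mass.
have Hx x : Omega x -> - M * weight x <= u x t * weight x <= M * weight x.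
  move=> Ox; have [/andP[w0 _] _ _ _ _] := wb x Ox.
  have := uM x t Ox (ab_I t tab); rewrite ler_norml => /andP[h1 h2].
  by rewrite !ler_wpM2r.
have bc c : bounded_continuous n Omega (fun x => c * weight x).
  by apply: bounded_continuousM => //; exact: bounded_continuous_cst.
have mZ c : avg (fun x => c * weight x) = c * avg weight.
  by rewrite RintegralZl//; exact: bounded_continuous_integrable.
have m0 : 0 <= avg weight.
  by apply: Rintegral_ge0 => x Ox; have [/andP[]] := wb x Ox.
rewrite ler_norml; apply/andP; split.
  apply: (@le_trans _ _ (- M * avg weight)).
    by rewrite mulNr lerN2 ler_piMr.
  rewrite -mZ; apply: le_Rintegral_bounded_continuous => // x Ox.
  by case/andP: (Hx x Ox).
apply: (@le_trans _ _ (M * avg weight)); last by rewrite ler_piMr.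
rewrite -mZ; apply: le_Rintegral_bounded_continuous => // x Ox.
by case/andP: (Hx x Ox).
Qed.

(** Since the mass of the weight may be less than 1, the upper bound on u passes to the average
    because [b1] is nonnegative. *)
Lemma wavg_le t : a < t < b -> wavg t <= b1.
Proof.
move=> tab; have bw := weight_bc _ (u_cont t (abt_I t tab)).
have [_ m1] := andP weight_mass.
apply: (@le_trans _ _ (b1 * avg weight)); last by rewrite ler_piMr.
rewrite -RintegralZl//; last exact: bounded_continuous_integrable.
apply: le_Rintegral_bounded_continuous => //.
  by apply: bounded_continuousM => //; exact: bounded_continuous_cst.
move=> x Ox; have [/andP[w0 _] _ _ _ _] := wb x Ox.
by rewrite ler_wpM2r// u_le// ab_I.
Qed.

Lemma wavg_close t : a < t < b ->
  `|wavg t - avg (fun x => u x t * phi x)| <= 2 * e * M * V.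
Proof.
move=> tab; have bw := weight_bc _ (u_cont t (abt_I t tab)).
have bu : bounded_continuous n Omega (u ^~ t).
  by split; [exact: u_cont (abt_I t tab)|exists M => x Ox; apply: uM => //; exact: ab_I].
have bup := bounded_continuousM _ _ _ _ bu phi_bc.
rewrite /wavg -RintegralB//; [|exact: bounded_continuous_integrable..].
have bd : bounded_continuous n Omega (fun x => u x t * weight x - u x t * phi x).
  have := bounded_continuousD _ _ _ _ bw
    (bounded_continuousM _ _ _ _ (bounded_continuous_cst n Omega (-1)) bup).
  by under eq_fun do rewrite mulN1r.
apply: (le_trans (le_normr_Rintegral mO (bounded_continuous_integrable _ _ oO bO _ bd))).
rewrite -(Rintegral_cst (lebesgue_rV R n) mO).
apply: le_Rintegral => //.
- apply: bounded_continuous_integrable => //; split.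
    move=> x Ox; apply: (@continuous_comp _ _ _ _ (fun r : R => `|r|)); first exact: bd.1.
    exact: norm_continuous.
  by have [N HN] := bd.2; exists N => x Ox; rewrite normr_id HN.
- by apply: bounded_continuous_integrable => //; exact: bounded_continuous_cst.
move=> x Ox; rewrite -mulrBr normrM mulrC.
apply: ler_pM => //; last by apply: uM => //; exact: ab_I.
have [/andP[w0 w1] w2 _ _ _] := wb x Ox; rewrite /weight ler_norml; apply/andP; split; lra.
Qed.

Let sqnorm_ge0 x : 0 <= sqnorm_grad n phi x.
Proof. by apply: sumr_ge0 => i _; exact: sqr_ge0. Qed.

(** By the chain rule this is the Laplacian of eta(phi). *)
Let flux x := cutoff2 e (phi x) * sqnorm_grad n phi x + cutoff1 e (phi x) * laplacian phi x.

Let flux_bc : bounded_continuous n Omega flux.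
Proof.
apply: (bounded_continuous_support_in _ _ oO bO K) => // x Ox; last first.
  by move=> Kx; rewrite /flux; have [_ -> ->] := off_K x Ox Kx; rewrite !mul0r addr0.
exact: (cvgD
  (cvgM (cont_cut _ (continuous_cutoff2 e) x Ox) (continuous_sqnorm_grad _ _ _ Cphi x Ox))
  (cvgM (cont_cut _ c_cut1 x Ox) (continuous_laplacian _ _ _ Cphi x Ox))).
Qed.

Let green w : C2_on Omega w ->
  avg (fun x => weight x * laplacian w x) = avg (fun x => w x * flux x).
Proof.
move=> Cw; exact: (green_cutoff _ _ _ _ _ _ _ _ oO bO cK KO Cphi Cw
  (fun s => is_derive_cutoff0 e s e_neq0) (is_derive_cutoff1 e)
  (continuous_cutoff2 e) off_K).
Qed.

(* Green's identity for the constant function 1. *)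
Let flux_int : avg flux = 0.
Proof.
have [C1 L1] := C2_on_cst n Omega 1.
have := green _ C1; rewrite L1.
under eq_Rintegral do rewrite mulr0.
under [in RHS]eq_Rintegral do rewrite mul1r.
by rewrite Rintegral_cst// mul0r.
Qed.

(** After Green's identity the integrand is u (z - mu1 y), with z = eta''(phi) |grad phi|^2 >= 0 and
    y = eta'(phi) phi. As |u| <= k where z is nonzero, u z >= - k z = - k (flux + mu1 y) >= - k flux
    - k mu1 phi. The flux integrates to 0 and phi to 1, so this part costs only k mu1. Replacing y
    by the weight in the other part costs 2 mu1 M e pointwise. *)
Let lap_avg t : a < t < b ->
  - (k * mu1) - mu1 * wavg t - 2 * mu1 * M * e * V <=
  avg (fun x => weight x * laplacian (u ^~ t) x).
Proof.
move=> tab; have It := abt_I t tab.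
rewrite green; last exact: C2_on_slice.
have bu : bounded_continuous n Omega (u ^~ t).
  by split; [exact: u_cont|exists M => x Ox; apply: uM => //; exact: ab_I].
have bw := weight_bc _ (u_cont t It).
have bc c : bounded_continuous n Omega (fun=> c) := bounded_continuous_cst n Omega c.
have b3 : bounded_continuous n Omega
    (fun x => - mu1 * (u x t * weight x) + (- (2 * mu1 * M * e))).
  by apply: bounded_continuousD => //; exact: bounded_continuousM.
have b2 : bounded_continuous n Omega
    (fun x => - (k * mu1) * phi x + (- mu1 * (u x t * weight x) + (- (2 * mu1 * M * e)))).
  by apply: bounded_continuousD => //; exact: bounded_continuousM.
have -> : - (k * mu1) - mu1 * wavg t - 2 * mu1 * M * e * V =
   avg (fun x => - k * flux x + (- (k * mu1) * phi x +
      (- mu1 * (u x t * weight x) + (- (2 * mu1 * M * e))))).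
  rewrite !Rintegral_linear// flux_int phi_int Rintegral_cst// -/V -/(wavg t).
  by rewrite mulr0 add0r mulr1 !mulNr addrA.
apply: le_Rintegral_bounded_continuous => //.
- by apply: bounded_continuousD => //; exact: bounded_continuousM.
- exact: bounded_continuousM.
move=> x Ox; have tab' := ab_I t tab.
have [/andP[w0 w1] w2 /andP[y0 y1] z0 yw] := wb x Ox.
have := uM x t Ox tab'; rewrite ler_norml => /andP[U1 U2].
rewrite /flux (_ : laplacian phi x = - (mu1 * phi x)); last by rewrite -eig// opprK.
(* Only the strip phi <= 2e matters: beyond it eta'' vanishes. *)
have zk : - k * (cutoff2 e (phi x) * sqnorm_grad n phi x) <=
    u x t * (cutoff2 e (phi x) * sqnorm_grad n phi x).
  have [pe|pe] := leP (phi x) (2 * e).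
    apply: ler_wpM2r; first by apply: mulr_ge0.
    by have := uk x t Ox tab' pe; rewrite ler_norml => /andP[].
  by rewrite (cutoff2_ge _ _ e_gt0 (ltW pe)) mul0r !mulr0.
have yp : cutoff1 e (phi x) * phi x <= phi x by rewrite ler_piMl// ltW// phi_gt0.
have uyw : u x t * (cutoff1 e (phi x) * phi x - weight x) <= M * (2 * e).
  rewrite (le_trans (ler_norm _))// normrM.
  by apply: ler_pM => //; exact: uM.
move: zk yp uyw; rewrite /weight.
set z := cutoff2 e (phi x) * _; set y := cutoff1 e (phi x) * phi x.
set w := cutoff0 e (phi x); set U := u x t => zk yp uyw.
have -> : cutoff1 e (phi x) * - (mu1 * phi x) = - (mu1 * y) by rewrite /y; ring.
have h1 : mu1 * (U * (y - w)) <= mu1 * (M * (2 * e)) by rewrite ler_pM2l.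
have h2 : k * mu1 * y <= k * mu1 * phi x by rewrite ler_wpM2l// mulr_ge0// ltW.
move: h1 h2 zk; clearbody z y w U; move: (phi x) => p h1 h2 zk.
nra.
Qed.

(** Jensen's inequality in tangent form: the tangent to [H] at [s] is integrated against the weight,
    and later [s] is the average itself. Because the mass is not exactly 1, the constant term
    [H s - H1 s * s] of the tangent leaves an error, bounded uniformly in [s] by means of
    monotonicity up to [b1]. *)
Lemma dwavg_ge t s : a < t < b -> `|s| <= M -> s <= b1 ->
  c0 * (H s + H1 s * (wavg t - s)) - mu1 * wavg t - k * mu1
  - 2 * e * V * (mu1 * M + c0 * (H b1 + H1 b1 * M)) <= dwavg t.
Proof.
move=> tab sM sb1; have It := abt_I t tab.
have s1 : s < 1 := le_lt_trans sb1 b1_lt1.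
have bw := weight_bc _ (u_cont t It).
have bl : bounded_continuous n Omega (fun x => weight x * laplacian (u ^~ t) x).
  have := weight_bc _ (continuous_laplacian _ _ _ (C2_on_slice t It)).
  by under eq_fun do rewrite mulrC.
have bc c : bounded_continuous n Omega (fun=> c) := bounded_continuous_cst n Omega c.
have bt : bounded_continuous n Omega (fun x => derive1 (u x) t * weight x).
  apply: weight_bc => x Ox.
  apply: (@continuous_comp _ _ _ (fun y => (y, t)) (fun p : 'rV[R]_n * R => derive1 (u p.1) p.2)).
    move=> W [[P Q] [/= nP nQ] PQW]; apply: filterS nP => y Py; apply: PQW.
    by split => //=; exact: nbhs_singleton nQ.
  exact: (C21_cont_t Cu).
have step1 : c0 * (H s - H1 s * s) * avg weight + (c0 * H1 s * wavg t +
    avg (fun x => weight x * laplacian (u ^~ t) x)) <= dwavg t.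
  have b2 : bounded_continuous n Omega
      (fun x => c0 * H1 s * (u x t * weight x) + weight x * laplacian (u ^~ t) x).
    by apply: bounded_continuousD => //; exact: bounded_continuousM.
  have -> : c0 * (H s - H1 s * s) * avg weight + (c0 * H1 s * wavg t +
      avg (fun x => weight x * laplacian (u ^~ t) x)) =
      avg (fun x => c0 * (H s - H1 s * s) * weight x +
        (c0 * H1 s * (u x t * weight x) + weight x * laplacian (u ^~ t) x)).
    by rewrite Rintegral_linear// Rintegral_linear.
  apply: le_Rintegral_bounded_continuous => //.
    by apply: bounded_continuousD => //; exact: bounded_continuousM.
  move=> x Ox; have [/andP[w0 _] _ _ _ _] := wb x Ox.
  have ux1 : u x t < 1 by apply: le_lt_trans b1_lt1; apply: u_le => //; exact: ab_I.
  have h1 := u_ineq x t Ox It.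
  have h2 : c0 * (H s + H1 s * (u x t - s)) <= c0 * H (u x t).
    by rewrite ler_wpM2l// H_tangent.
  have h3 : (laplacian (u ^~ t) x + c0 * (H s + H1 s * (u x t - s))) * weight x <=
     derive1 (u x) t * weight x.
    by rewrite ler_wpM2r//; apply: le_trans h1; rewrite lerD2l.
  apply: le_trans h3; rewrite le_eqVlt; apply/orP; left; apply/eqP.
  by move: (laplacian _ x) (weight x) (u x t) => *; ring.
have step2 := lap_avg t tab.
have /andP[m0 m1] := weight_mass.
have hs0 := H_ge0 s s1; have hs1 := H1_ge0 s s1.
have hb0 := H_nd s b1 sb1 b1_lt1; have hb1 := H1_nd s b1 sb1 b1_lt1.
have h1s : `|H1 s * s| <= H1 b1 * M by rewrite normrM ger0_norm// ler_pM.
have al : `|H s - H1 s * s| <= H b1 + H1 b1 * M.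
  by rewrite (le_trans (ler_normB _ _))// lerD// ger0_norm.
(* The intercept of the tangent times the missing mass. *)
have key : (H s - H1 s * s) * (1 - avg weight) <= (H b1 + H1 b1 * M) * (2 * e * V).
  rewrite (le_trans (ler_norm _))// normrM; apply: ler_pM => //.
  by rewrite ger0_norm; lra.
have := ler_wpM2l c0_ge0 key.
move: step1 step2 => p1 p2 p3; lra.
Qed.

End cutoff_window.

(** The average against phi itself is not differentiated; it is a uniform limit of differentiable
    functions satisfying the differential inequality up to k. The bound [M] is fixed before k, so it
    survives the limit. *)
Lemma approx_average : exists2 M : R, 0 <= M &
  forall k, 0 < k -> exists w dw : R -> R, forall t, a < t < b ->
    [/\ is_derive t 1 w (dw t), `|w t| <= M, w t <= b1,
        `|w t - avg (fun x => u x t * phi x)| <= k &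
        c0 * H (w t) - mu1 * w t - k <= dw t].
Proof.
have [M M0 uM] := u_bounded; exists M => // k k0.
(* The error k is split in two: smallness of u near the boundary costs mu1 times this quantity,
   hence k/2, and the terms of order e get the other half. *)
have k1 : 0 < k / (2 * mu1) by rewrite divr_gt0// mulr_gt0.
have [e1 e10 He1] := u_small _ k1.
(* [A] collects the constants of the errors of order e in [wavg_close] and [dwavg_ge]. *)
pose A := V * (mu1 * M + c0 * (H b1 + H1 b1 * M) + M).
have A0 : 0 <= A.
  rewrite /A mulr_ge0// !addr_ge0// ?mulr_ge0// ?addr_ge0 ?mulr_ge0 ?H_ge0 ?H1_ge0//.
  exact: ltW.
(* The first entry puts the strip phi <= 2e inside the one where u is small; the second makes 2 e
   [A] at most k/2. *)
pose e := Num.min (e1 / 2) (k / (4 * (A + 1))).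
have e0 : 0 < e by rewrite lt_min !divr_gt0//= mulr_gt0// ltr_wpDl.
have ee1 : 2 * e <= e1.
  have : e <= e1 / 2 by rewrite ge_min lexx.
  by rewrite ler_pdivlMr// mulrC.
have eA : 2 * e * A <= k / 2.
  have : e <= k / (4 * (A + 1)) by rewrite ge_min lexx orbT.
  rewrite ler_pdivlMr ?mulr_gt0// ?ltr_wpDl// => H0.
  have : 0 <= e * A by rewrite mulr_ge0// ltW.
  lra.
have k1' : 0 <= k / (2 * mu1) by exact: ltW.
have uk x t : Omega x -> a <= t <= b -> phi x <= 2 * e -> `|u x t| <= k / (2 * mu1).
  by move=> Ox tab pe; apply: He1 => //; exact: le_trans ee1.
exists (wavg e), (dwavg e) => t tab.
have wM := wavg_norm e M e0 M0 uM t tab.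
have wb1 := wavg_le e e0 t tab.
have A1 : 0 <= V * M by rewrite mulr_ge0.
have A2 : 0 <= V * (mu1 * M + c0 * (H b1 + H1 b1 * M)).
  rewrite mulr_ge0// !addr_ge0// ?mulr_ge0// ?addr_ge0 ?mulr_ge0 ?H_ge0 ?H1_ge0//.
  exact: ltW.
have eA1 : 2 * e * (V * M) + 2 * e * (V * (mu1 * M + c0 * (H b1 + H1 b1 * M))) <= k / 2.
  by apply: le_trans eA; rewrite /A; lra.
have eV1 : 0 <= e * (V * M) by rewrite mulr_ge0// ltW.
have eV2 : 0 <= e * (V * (mu1 * M + c0 * (H b1 + H1 b1 * M))) by rewrite mulr_ge0// ltW.
split => //.
- exact: (is_derive_wavg e e0 t tab).
- have := wavg_close e M e0 uM t tab.
  by move=> /le_trans; apply; lra.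
- have := dwavg_ge e M _ e0 k1' uM uk t (wavg e t) tab wM wb1.
  apply: le_trans; rewrite subrr mulr0 addr0.
  have -> : k / (2 * mu1) * mu1 = k / 2 by field; rewrite gt_eqF.
  lra.
Qed.

End solution_on_window.

(** * Differential inequalities *)

Section real_calculus.
Context {R : realType}.
Implicit Types (x y : R) (f df : R -> R).

Lemma mean_value f df x y : x < y ->
  (forall z, x <= z <= y -> is_derive z 1 f (df z)) ->
  exists2 z, x < z < y & f y - f x = df z * (y - x).
Proof.
move=> xy D.
have [||z] := @MVT R f df x y xy.
- by move=> z; rewrite in_itv /= => /andP[xz zy]; apply: D; rewrite !ltW.
- apply: derivable_within_continuous => z; rewrite in_itv /= => xzy.
  by case: (D z xzy).
by rewrite in_itv /= => zxy E; exists z.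
Qed.

Lemma derivative_ge f df (c x y : R) : x <= y ->
  (forall z, x <= z <= y -> is_derive z 1 f (df z)) ->
  (forall z, x <= z <= y -> c <= df z) -> c * (y - x) <= f y - f x.
Proof.
rewrite le_eqVlt => /predU1P[->|xy] D Dc; first by rewrite !subrr mulr0.
have [z /andP[xz zy] ->] := mean_value _ _ _ _ xy D.
by rewrite ler_wpM2r ?subr_ge0 ?(ltW xy)// Dc// !ltW.
Qed.

Lemma derivative_le f df (c x y : R) : x <= y ->
  (forall z, x <= z <= y -> is_derive z 1 f (df z)) ->
  (forall z, x <= z <= y -> df z <= c) -> f y - f x <= c * (y - x).
Proof.
rewrite le_eqVlt => /predU1P[->|xy] D Dc; first by rewrite !subrr mulr0.
have [z /andP[xz zy] ->] := mean_value _ _ _ _ xy D.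
by rewrite ler_wpM2r ?subr_ge0 ?(ltW xy)// Dc// !ltW.
Qed.

End real_calculus.

(** * The convex function 1/g and antiderivatives of g *)

Section reciprocal.
Context {R : realType} (g : R -> R).
Hypotheses (hg : C2_below1 g) (g_gt0 : forall s, s < 1 -> 0 < g s)
  (hg1 : forall s, s < 1 -> derive1 g s <= 0)
  (hg2 : forall s, s < 1 -> 0 <= derive1 (derive1 (fun r => (g r)^-1)) s).
Implicit Types s r : R.

Let h s : R := (g s)^-1.
Let h1 s : R := - (h s * h s) * derive1 g s.
Let h2 s : R := derive1 (derive1 h) s.

Lemma is_derive_g s : s < 1 -> is_derive s 1 g (derive1 g s).
Proof.
by move=> s1; have [dg _ _] := hg s s1; rewrite derive1E; exact: (DeriveDef dg).
Qed.

Lemma is_derive_inv_g s : s < 1 -> is_derive s 1 h (h1 s).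
Proof.
move=> s1; have [dg dgE] := is_derive_g _ s1.
have gs : g s != 0 by rewrite gt_eqF ?g_gt0.
split; first exact: (derivableV gs dg).
rewrite (deriveV gs dg) /h1 derive1E /GRing.scale /=; congr (- _ * _).
by rewrite /h -invfM -expr2.
Qed.

Let h1E s : s < 1 -> derive1 h s = h1 s.
Proof. by move=> s1; rewrite derive1E; case: (is_derive_inv_g s s1). Qed.

Let near_lt1 s : s < 1 -> \near s, s < 1.
Proof. by move=> s1; exact: (cvgr_lt s cvg_id _ s1). Qed.

Lemma is_derive_inv_g1 s : s < 1 -> is_derive s 1 h1 (h2 s).
Proof.
move=> s1.
have [dg ddg _] := hg s s1.
have gs : g s != 0 by rewrite gt_eqF ?g_gt0.
(* The explicit formula [h1] is the derivative of [h] only below 1, so the second derivative is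
   transferred through a neighbourhood of s. *)
have E : \near s, h1 s = derive1 h s.
  by apply: filterS (near_lt1 s s1) => r r1; rewrite h1E.
have dh : derivable h1 s 1.
  have Dg1 : is_derive s 1 (derive1 g) (derive1 (derive1 g) s).
    by rewrite derive1E; exact: (DeriveDef ddg).
  have Dh := is_derive_inv_g s s1.
  have [] // := is_derive_ext (G := h1)
    (is_deriveM (is_deriveN (is_deriveM Dh Dh)) Dg1) (fun=> erefl) erefl.
by split; [exact: dh|rewrite (near_eq_derive _ E) /h2 derive1E].
Qed.

Lemma inv_g_ge0 s : s < 1 -> 0 <= h s.
Proof. by move=> s1; rewrite invr_ge0 ltW// g_gt0. Qed.

Lemma inv_g1_ge0 s : s < 1 -> 0 <= h1 s.
Proof.
move=> s1; rewrite /h1 mulNr -mulrN mulr_ge0 ?oppr_ge0 ?hg1//.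
by rewrite mulr_ge0// inv_g_ge0.
Qed.

Lemma inv_g_nd s r : s <= r -> r < 1 -> h s <= h r.
Proof.
move=> sr r1; rewrite -subr_ge0.
have := @derivative_ge _ h h1 0 s r sr; rewrite mul0r; apply.
  by move=> z /andP[_ zr]; apply: is_derive_inv_g; exact: le_lt_trans r1.
by move=> z /andP[_ zr]; apply: inv_g1_ge0; exact: le_lt_trans r1.
Qed.

Lemma inv_g1_nd s r : s <= r -> r < 1 -> h1 s <= h1 r.
Proof.
move=> sr r1; rewrite -subr_ge0.
have := @derivative_ge _ h1 h2 0 s r sr; rewrite mul0r; apply.
  by move=> z /andP[_ zr]; apply: is_derive_inv_g1; exact: le_lt_trans r1.
by move=> z /andP[_ zr]; apply: hg2; exact: le_lt_trans r1.
Qed.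

(** The derivative [h1] is nondecreasing, so the mean value theorem on the interval between s and r
    gives the tangent inequality on either side of s. *)
Lemma inv_g_tangent s r : s < 1 -> r < 1 -> h s + h1 s * (r - s) <= h r.
Proof.
move=> s1 r1; have [sr|/ltW rs] := leP s r.
  rewrite addrC -lerBrDr; apply: (@derivative_ge _ h h1) => //.
    by move=> z /andP[_ zr]; apply: is_derive_inv_g; exact: le_lt_trans r1.
  by move=> z /andP[sz zr]; apply: inv_g1_nd => //; exact: le_lt_trans r1.
have : h s - h r <= h1 s * (s - r).
  apply: (@derivative_le _ h h1) => //.
    by move=> z /andP[_ zr]; apply: is_derive_inv_g; exact: le_lt_trans s1.
  by move=> z /andP[sz zr]; apply: inv_g1_nd => //; exact: le_lt_trans s1.
by move: (h s) (h r) (h1 s) => *; lra.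
Qed.

Lemma g_ni s r : s <= r -> r < 1 -> g r <= g s.
Proof.
move=> sr r1; rewrite -[leRHS]invrK -[leLHS]invrK lef_pV2 ?posrE ?invr_gt0 ?g_gt0//.
  exact: inv_g_nd.
exact: le_lt_trans r1.
Qed.

Lemma continuous_g s : s < 1 -> {for s, continuous g}.
Proof.
by move=> s1; apply/differentiable_continuous/derivable1_diffP; case: (is_derive_g s s1).
Qed.

Lemma integrable_g s r : r < 1 -> lebesgue_measure.-integrable `[s, r] (EFin \o g).
Proof.
move=> r1; apply: continuous_compact_integrable; first exact: segment_compact.
apply: continuous_in_subspaceT => z; rewrite inE /= in_itv /= => /andP[_ zr].
by apply: continuous_g; exact: le_lt_trans r1.
Qed.

Lemma antiderivative_g p : exists G : R -> R,
  forall x : R, p < x < 1 -> is_derive x 1 G (g x).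
Proof.
exists (fun x => \int[lebesgue_measure]_(t in `[p, x]) g t) => x /andP[px x1].
(* The midpoint of x and 1 leaves room to the right of x while staying where g is continuous. *)
have xu : x < (x + 1) / 2 by lra.
have u1 : (x + 1) / 2 < 1 by lra.
have [dG GE] := continuous_FTC1_closed xu (integrable_g p _ u1) px (continuous_g x x1).
by split; [exact: dG|rewrite -derive1E; exact: GE].
Qed.

Lemma integral_g_ge (G : R -> R) p z y : z < y -> y < 1 -> p <= z ->
  (forall x : R, z <= x <= y -> is_derive x 1 G (g x)) ->
  ((G y - G z)%:E <= \int[lebesgue_measure]_(s in [set s : R | p <= s < 1]%R) (g s)%:E)%E.
Proof.
move=> zy y1 pz DG.
have cG x : z <= x <= y -> {for x, continuous G}.
  by move=> xzy; apply/differentiable_continuous/derivable1_diffP; case: (DG x xzy).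
have <- : (\int[lebesgue_measure]_(s in `[z, y]) (g s)%:E = (G y - G z)%:E)%E.
  rewrite (@continuous_FTC2 _ g G)//.
  - apply: continuous_in_subspaceT => x; rewrite inE /= in_itv /= => /andP[_ xy].
    by apply: continuous_g; exact: le_lt_trans y1.
  - split.
    + move=> x; rewrite in_itv /= => /andP[zx xy].
      have zxy : z <= x <= y by rewrite !ltW.
      by case: (DG x zxy).
    + by apply: cvg_at_right_filter; apply: cG; rewrite lexx ltW.
    + by apply: cvg_at_left_filter; apply: cG; rewrite lexx ltW.
  - move=> x; rewrite in_itv /= => /andP[zx xy]; rewrite derive1E.
    have zxy : z <= x <= y by rewrite !ltW.
    by case: (DG x zxy).
have -> : [set s : R | p <= s < 1] = `[p, 1[%classic.
  by apply/seteqP; split => s /=; rewrite in_itv.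
apply: ge0_subset_integral => //.
- apply/measurable_EFinP; apply: subspace_continuous_measurable_fun => //.
  apply: continuous_in_subspaceT => x; rewrite inE /= in_itv /= => /andP[_ x1].
  exact: continuous_g.
- by move=> s /=; rewrite in_itv /= => /andP[_ s1]; rewrite lee_fin ltW// g_gt0.
- move=> s /=; rewrite !in_itv /= => /andP[zs sy].
  by rewrite (le_trans pz zs) (le_lt_trans sy y1).
Qed.

Lemma le_of_small (x y A : R) : 0 <= A -> (forall k : R, 0 < k -> x <= y + k * A) -> x <= y.
Proof.
move=> A0 H; apply/ler_addgt0Pr => e e0.
have e1 : 0 < e / (A + 1) by rewrite divr_gt0// ltr_wpDl.
apply: (le_trans (H _ e1)); rewrite lerD2l.
rewrite mulrAC ler_pdivrMr ?ltr_wpDl//.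
by rewrite ler_wpM2l ?lerDl// ltW.
Qed.

Lemma limit_bounds (M b1 : R) (I : set R) (E : R -> R) :
  (forall k : R, 0 < k -> exists w : R -> R, forall t, I t ->
    [/\ `|w t| <= M, w t <= b1 & `|w t - E t| <= k]) ->
  forall t, I t -> - M <= E t <= b1.
Proof.
move=> approx t It; apply/andP; split; apply: (@le_of_small _ _ 1) => // k k0.
  have [w H] := approx k k0; have [+ _ +] := H t It.
  by rewrite !ler_norml => /andP[? ?] /andP[? ?]; lra.
have [w H] := approx k k0; have [_ + +] := H t It.
by rewrite !ler_norml => ? /andP[? ?]; lra.
Qed.

Section travel_time.
Variables (c M b1 a b : R) (E : R -> R).
Hypotheses (M_ge0 : 0 <= M) (b1_lt1 : b1 < 1)
  (E_bounds : forall t, a < t < b -> - M <= E t <= b1)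
  (approx : forall k : R, 0 < k -> exists w dw : R -> R, forall t : R, a < t < b ->
    [/\ is_derive t 1 w (dw t), `|w t| <= M, w t <= b1, `|w t - E t| <= k &
        c * h (w t) - k <= dw t]).

(** Along an approximant, (G(w))' = g(w) w' >= c - k g(w). With [L] a bound for g on [-M, b1],
    integration loses k L (t2 - t1), and replacing w by E at the two ends loses 2 k L since G is
    [L]-Lipschitz there. Then k tends to 0. *)
Lemma travel_time (G : R -> R) t1 t2 : a < t1 -> t1 <= t2 -> t2 < b ->
  (forall x : R, - M <= x <= b1 -> is_derive x 1 G (g x)) ->
  c * (t2 - t1) <= G (E t2) - G (E t1).
Proof.
move=> at1 t12 t2b DG.
have M1 : - M < 1 by apply: (@le_lt_trans _ _ 0) => //; rewrite oppr_le0.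
(* As g is nonincreasing, its value at the left end bounds it on [-M, b1]. *)
pose L := g (- M); have L0 : 0 < L := g_gt0 _ M1.
have gL x : - M <= x <= b1 -> 0 < g x <= L.
  move=> /andP[Mx xb]; have x1 := le_lt_trans xb b1_lt1.
  by rewrite g_gt0//=; exact: g_ni.
have Gle x y : - M <= x <= b1 -> - M <= y <= b1 -> x <= y -> 0 <= G y - G x <= L * (y - x).
  move=> /andP[Mx xb] /andP[My yb] xy.
  have D z : x <= z <= y -> is_derive z 1 G (g z).
    by move=> /andP[xz zy]; apply: DG; rewrite (le_trans Mx xz) (le_trans zy yb).
  have B z : x <= z <= y -> 0 < g z <= L.
    by move=> /andP[xz zy]; apply: gL; rewrite (le_trans Mx xz) (le_trans zy yb).
  apply/andP; split.
    have := @derivative_ge _ G g 0 x y xy D; rewrite mul0r; apply.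
    by move=> z /B /andP[/ltW].
  by apply: (@derivative_le _ G g) => // z /B /andP[].
have Glip x y : - M <= x <= b1 -> - M <= y <= b1 -> `|G x - G y| <= L * `|x - y|.
  move=> xM yM; have [xy|/ltW yx] := leP x y.
    have /andP[h0 hL] := Gle x y xM yM xy.
    by rewrite distrC ger0_norm// (distrC x) (ger0_norm (x := y - x)) ?subr_ge0.
  have /andP[h0 hL] := Gle y x yM xM yx.
  by rewrite ger0_norm// (ger0_norm (x := x - y)) ?subr_ge0.
apply: (@le_of_small _ _ (L * (t2 - t1) + 2 * L)).
  by rewrite addr_ge0 ?mulr_ge0 ?subr_ge0// ltW.
move=> k k0; have [w [dw H]] := approx k k0.
have tab t : t1 <= t <= t2 -> a < t < b.
  by move=> /andP[x y]; rewrite (lt_le_trans at1 x) (le_lt_trans y t2b).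
have wM t : t1 <= t <= t2 -> - M <= w t <= b1.
  by move=> /tab/H[_ + wb _ _]; rewrite ler_norml => /andP[-> _].
have EM t : t1 <= t <= t2 -> - M <= E t <= b1 by move=> /tab; exact: E_bounds.
have GE t : t1 <= t <= t2 -> `|G (w t) - G (E t)| <= L * k.
  move=> tt; apply: (le_trans (Glip _ _ (wM t tt) (EM t tt))).
  by have [_ _ _ + _] := H t (tab t tt); rewrite ler_pM2l.
have step : (c - k * L) * (t2 - t1) <= G (w t2) - G (w t1).
  apply: (@derivative_ge _ (G \o w) (fun t => g (w t) * dw t)) => // t tt.
    have [dwt _ _ _ _] := H t (tab t tt).
    exact: (is_derive1_comp (DG _ (wM t tt)) dwt).
  have [_ _ _ _ dwk] := H t (tab t tt); have /andP[g0 gwL] := gL _ (wM t tt).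
  have : g (w t) * (c * h (w t) - k) <= g (w t) * dw t by rewrite ler_pM2l.
  apply: le_trans; rewrite mulrBr mulrCA /h divff ?gt_eqF// mulr1.
  by rewrite lerD2l lerN2 mulrC ler_pM2l.
have t11 : t1 <= t1 <= t2 by rewrite lexx.
have t22 : t1 <= t2 <= t2 by rewrite lexx andbT.
have := GE t1 t11; have := GE t2 t22; rewrite !ler_norml => /andP[? ?] /andP[? ?].
lra.
Qed.

End travel_time.

End reciprocal.

(** The integrating factor exp(-r t) applied to w - a0 - m t has derivative exp(-r t) (w' - m - r (w
    - a0) + r m t). The inequality for w' and r m t >= 0 make it at least -k, the factor being at
    most 1 for t >= 0. Then k tends to 0. *)
Lemma linear_growth {R : realType} (m r a0 a b : R) (E : R -> R) (t1 t2 : R) :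
  0 <= m -> 0 <= r -> 0 <= a ->
  (forall k : R, 0 < k -> exists w dw : R -> R, forall t : R, a < t < b ->
    [/\ is_derive t 1 w (dw t), `|w t - E t| <= k &
        m + r * (w t - a0) - k <= dw t]) ->
  a < t1 -> t1 <= t2 -> t2 < b ->
  expR (- r * t1) * (E t1 - a0 - m * t1) <= expR (- r * t2) * (E t2 - a0 - m * t2).
Proof.
move=> m0 r0 a_ge0 approx at1 t12 t2b.
have ex1 t : 0 <= t -> 0 < expR (- r * t) <= 1.
  by move=> t0; rewrite expR_gt0 expR_le1 mulNr oppr_le0 mulr_ge0.
have t10 : 0 <= t1 by rewrite (le_trans a_ge0)// ltW.
apply: (@le_of_small _ _ _ (t2 - t1 + 2)); first by rewrite addr_ge0 ?subr_ge0.
move=> k k0; have [w [dw H]] := approx k k0.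
have tab t : t1 <= t <= t2 -> a < t < b.
  by move=> /andP[x y]; rewrite (lt_le_trans at1 x) (le_lt_trans y t2b).
pose Z t := expR (- r * t) * (w t - a0 - m * t).
pose dZ t := expR (- r * t) * (dw t - m) + (w t - a0 - m * t) * (expR (- r * t) * - r).
have DZ t : t1 <= t <= t2 -> is_derive t 1 Z (dZ t).
  move=> tt; have [dwt _ _] := H t (tab t tt).
  have De : is_derive t 1 (fun t => expR (- r * t)) (expR (- r * t) * - r).
    apply: (is_derive1_comp (is_derive_expR _)).
    apply: (is_derive_ext (is_deriveZ (- r) (is_derive_id t (1:R)))) => //.
    by rewrite /GRing.scale /= mulr1.
  have Dl : is_derive t 1 (fun t => w t - a0 - m * t) (dw t - m).
    apply: (is_derive_ext (is_deriveB (is_deriveB dwt (is_derive_cst a0 t (1:R)))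
      (is_deriveZ m (is_derive_id t (1:R))))) => //.
    by rewrite /GRing.scale /= mulr1 subr0.
  apply: (is_derive_ext (is_deriveM De Dl)) => //.
have step : - k * (t2 - t1) <= Z t2 - Z t1.
  apply: (@derivative_ge _ Z dZ) => // t tt.
  have [_ _ dwk] := H t (tab t tt).
  have t0 : 0 <= t by case/andP: tt => t1t _; exact: le_trans t1t.
  have /andP[e0 e1] := ex1 t t0; rewrite /dZ.
  have -> : expR (- r * t) * (dw t - m) + (w t - a0 - m * t) * (expR (- r * t) * - r) =
    expR (- r * t) * (dw t - (m + r * (w t - a0) - k) + r * (m * t)) - expR (- r * t) * k.
    by ring.
  have : 0 <= expR (- r * t) * (dw t - (m + r * (w t - a0) - k) + r * (m * t)).
    apply: mulr_ge0; first exact: ltW.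
    by apply: addr_ge0; [rewrite subr_ge0|rewrite !mulr_ge0].
  have : expR (- r * t) * k <= 1 * k by rewrite ler_pM2r.
  lra.
have close t : t1 <= t <= t2 -> `|Z t - expR (- r * t) * (E t - a0 - m * t)| <= k.
  move=> tt; have [_ wE _] := H t (tab t tt).
  have t0 : 0 <= t by case/andP: tt => t1t _; exact: le_trans t1t.
  have /andP[e0 e1] := ex1 t t0.
  rewrite /Z -mulrBr normrM (ger0_norm (ltW e0)) -[leRHS]mul1r.
  have -> : w t - a0 - m * t - (E t - a0 - m * t) = w t - E t by ring.
  by rewrite ler_pM// ltW.
have t11 : t1 <= t1 <= t2 by rewrite lexx.
have t22 : t1 <= t2 <= t2 by rewrite lexx andbT.
have := close t1 t11; have := close t2 t22; rewrite !ler_norml => /andP[? ?] /andP[? ?].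
lra.
Qed.

(** * Upper bounds on the touchdown time *)

Lemma time_interval_next {R : realType} (T : \bar R) t :
  time_interval T t -> exists2 b, t < b & time_interval T b.
Proof.
move=> It; have := @open_time_interval R T; rewrite openE => /(_ t It) /=.
move=> /nbhs_ballP[e /= e0 H]; exists (t + e / 2); first by rewrite ltrDl divr_gt0.
apply: H; rewrite /ball /= opprD addrA subrr add0r normrN ger0_norm ?divr_ge0 ?ltW//.
by rewrite ltr_pdivrMr// ltr_pMr// ltr1n.
Qed.

Lemma le_of_time_interval {R : realType} (T : \bar R) (z : R) : 0 <= z ->
  (forall t, time_interval T t -> t <= z) -> (T <= z%:E)%E.
Proof.
move=> z0 H; rewrite leNgt; apply/negP => zT.
have [t zt tT] : exists2 t : R, z < t & (t%:E < T)%E.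
  case: T zT H => [r|_|//] => [zr _|_].
    by exists ((z + r) / 2); rewrite ?lte_fin; move: zr; rewrite lte_fin => zr; lra.
  by exists (z + 1); [rewrite ltrDl|exact: ltry].
have := H t (conj (le_lt_trans z0 zt) tT).
by rewrite leNgt zt.
Qed.

Lemma ereal_sup_lt1_bound {R : realType} (P : Type) (A : set P) (F : P -> R) :
  (ereal_sup [set (F p)%:E | p in A] < 1)%E ->
  exists2 b1 : R, 0 <= b1 < 1 & forall p, A p -> F p <= b1.
Proof.
move=> sup1.
have ub p : A p -> ((F p)%:E <= ereal_sup [set (F p)%:E | p in A])%E.
  by move=> Ap; apply: ereal_sup_ubound; exists p.
case: (ereal_sup _) sup1 ub => [r|//|_ ub].
(* The bound is made nonnegative so that it passes to averages against weights of mass at most 1. *)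
- rewrite lte_fin => r1 ub; exists (Num.max 0 r).
    by rewrite le_max lexx /= gt_max ltr01.
  by move=> p /ub; rewrite lee_fin le_max => ->; rewrite orbT.
- exists 0; first by rewrite lexx ltr01.
  by move=> p /ub; rewrite leeNy_eq.
Qed.

Section touchdown.
Context {R : realType} (n : nat) (Omega : set 'rV[R]_n) (f : 'rV[R]_n -> R)
  (delta1 mu1 lambda : R) (g : R -> R) (phi1 u0 : 'rV[R]_n -> R) (T : \bar R)
  (u : 'rV[R]_n -> R -> R).
Hypotheses (hOmega : bounded_C2_domain Omega)
  (f_ge : forall x, Omega x -> delta1 <= f x) (delta1_gt0 : 0 < delta1)
  (hg : C2_below1 g) (g_gt0 : forall s, s < 1 -> 0 < g s)
  (hg1 : forall s, s < 1 -> derive1 g s <= 0)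
  (hg2 : forall s, s < 1 -> 0 <= derive1 (derive1 (fun r => (g r)^-1)) s)
  (mu1_gt0 : 0 < mu1) (hphi1 : dirichlet_eigenfunction Omega mu1 phi1)
  (phi1_gt0 : forall x, Omega x -> 0 < phi1 x)
  (phi1_int : \int[lebesgue_rV R n]_(x in Omega) phi1 x = 1)
  (lambda_gt0 : 0 < lambda)
  (hu0 : initial_datum Omega u0) (hu : is_solution Omega f g lambda u0 T u).

Definition average t : R := \int[lebesgue_rV R n]_(x in Omega) (u x t * phi1 x).
Definition average0 : R := \int[lebesgue_rV R n]_(x in Omega) (u0 x * phi1 x).

Let I := time_interval T.

Let oO : open Omega. Proof. exact: domain_open hOmega. Qed.
Let bO : bounded_set Omega. Proof. exact: domain_bounded hOmega. Qed.
Let neO : Omega !=set0. Proof. exact: domain_nonempty hOmega. Qed.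
Let oI : open I. Proof. exact: open_time_interval. Qed.
Let mO : measurable Omega. Proof. exact: open_measurable_rV. Qed.

Let I_down s t : I t -> 0 < s -> s <= t -> I s.
Proof.
by move=> [_ tT] s0 st; split => //; apply: le_lt_trans tT; rewrite lee_fin.
Qed.

Lemma solution_lt1 x t : Omega x -> I t -> u x t < 1.
Proof.
move=> Ox It; have [b1 /andP[_ b11] ub] := ereal_sup_lt1_bound _ _ _ (sol_lt1 hu It).
apply: le_lt_trans b11; apply: (ub (x, t)); split => /=; first exact: subset_closure.
by have [t0 _] := It; rewrite t0 lexx.
Qed.

Lemma solution_supersolution x t : Omega x -> I t ->
  laplacian (u ^~ t) x + (lambda * delta1) * (g (u x t))^-1 <= derive1 (u x) t.
Proof.
move=> Ox It; rewrite (sol_eq hu Ox It) lerD2l.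
by rewrite ler_pM2r ?invr_gt0 ?g_gt0 ?solution_lt1// ler_pM2l// f_ge.
Qed.

(** The order of quantifiers serves the limit t1 -> 0: [b1] depends on [t2] alone, whereas the lower
    bound -M may get worse as [t1] decreases, u being controlled only from above near time 0. *)
Lemma solution_window t2 : I t2 -> exists2 b1 : R, 0 <= b1 < 1 &
  forall t1, 0 < t1 -> t1 <= t2 -> exists a b M : R,
    [/\ 0 < a < t1, t2 < b, 0 <= M & forall t, a < t < b -> - M <= average t <= b1] /\
    forall k : R, 0 < k -> exists w dw : R -> R, forall t : R, a < t < b ->
    [/\ is_derive t 1 w (dw t), `|w t| <= M, w t <= b1, `|w t - average t| <= k &
        (lambda * delta1) * (g (w t))^-1 - mu1 * w t - k <= dw t].
Proof.
move=> It2; have [b t2b Ib] := time_interval_next _ _ It2.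
have [b1 b1P ub] := ereal_sup_lt1_bound _ _ _ (sol_lt1 hu Ib); exists b1 => // t1 t10 t12.
have /andP[b10 b11] := b1P.
(* The window [t1/2, b], with b beyond [t2], contains [t1, t2] in its interior and stays away from
   time 0. *)
have a0 : 0 < t1 / 2 by rewrite divr_gt0.
have abI t : t1 / 2 <= t <= b -> I t.
  by move=> /andP[at_ tb]; apply: I_down Ib _ tb; exact: lt_le_trans at_.
have ab : t1 / 2 < b by lra.
have [M M0 H] := approx_average n Omega phi1 I u (t1 / 2) b oO bO neO
  (eigen_cont hphi1) (eigen_bnd hphi1) phi1_gt0 oI (sol_C21 hu) (sol_cont hu)
  (sol_bnd hu) ab abI mu1 (lambda * delta1) b1 (fun s => (g s)^-1)
  (fun s => - ((g s)^-1 * (g s)^-1) * derive1 g s) (eigen_C2 hphi1) mu1_gt0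
  (eigen_eq hphi1) phi1_int (ltW (mulr_gt0 lambda_gt0 delta1_gt0)) b10 b11
  (inv_g_ge0 g g_gt0) (inv_g1_ge0 g g_gt0 hg1) (inv_g_nd g hg g_gt0 hg1)
  (inv_g1_nd g hg g_gt0 hg2) (inv_g_tangent g hg g_gt0 hg2)
  solution_supersolution
  (fun x t Ox tab => ub (x, t) (conj (subset_closure Ox)
     (introT andP (conj (lt_le_trans a0 (proj1 (andP tab))) (proj2 (andP tab)))))).
exists (t1 / 2), b, M; split; last exact: H.
split => //; first by rewrite a0 /=; lra.
apply: (limit_bounds _ _ [set t | t1 / 2 < t < b]) => k k0.
by have [w [dw Hw]] := H k k0; exists w => t tab; have [] := Hw t tab.
Qed.

(** Since phi1 is bounded, convergence to the initial datum in L^1 gives convergence of the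
    averages. *)
Lemma average_cvg0 (k : R) : 0 < k -> exists2 d : R, 0 < d &
  forall t, 0 < t < d -> I t -> `|average t - average0| <= k.
Proof.
move=> k0.
have [P P0 phiP] := phi_bounded n Omega phi1 oO bO (eigen_cont hphi1) (eigen_bnd hphi1).
have P1 : 0 < P + 1 by rewrite ltr_wpDl.
have kP : 0 < k / (P + 1) by rewrite divr_gt0.
have mphi : measurable_fun Omega phi1.
  by apply: continuous_measurable_rV => //; exact: C2_cont (eigen_C2 hphi1).
have bphi : [bounded phi1 x | x in Omega].
  exists P; split; first exact: num_real.
  by move=> y Py x Ox /=; rewrite (le_trans (phiP x Ox))// ltW.
have iu0 := datum_L1 hu0.
have := sol_init hu.
move=> /fine_cvgP[fin_near /cvgrPdist_le /(_ _ kP)].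
move=> near_le.
have : \forall t \near 0^'+,
    (\int[lebesgue_rV R n]_(x in Omega) `|(u x t - u0 x)%:E| \is a fin_num)%E /\
    `|0 - fine (\int[lebesgue_rV R n]_(x in Omega) `|(u x t - u0 x)%:E|)%E| <= k / (P + 1).
  by apply: filterS2 fin_near near_le.
move=> [d /= d0 Hd]; exists d => // t /andP[t0 td] It.
have tb : `|0 - t| < d by rewrite sub0r normrN gtr0_norm.
have [fin_t le_t] := Hd t tb t0.
(* At a fixed positive time u is bounded and continuous on Omega, by compactness of a window around
   that time. *)
have iu : (lebesgue_rV R n).-integrable Omega (EFin \o (u ^~ t)).
  have [b t_b Ib] := time_interval_next _ _ It.
  have abI s : t / 2 <= s <= b -> I s.
    by move=> /andP[at_ sb]; apply: I_down Ib _ sb; lra.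
  have ab : t / 2 < b by lra.
  have [M M0 uM] := u_bounded n Omega I u (t / 2) b oO bO neO oI (sol_cont hu)
    (sol_bnd hu) ab abI.
  apply: (integrable_bounded_open _ _ _ M) => //.
    exact: C2_cont (C2_on_slice n Omega I u (sol_C21 hu) t It).
  by move=> x Ox; apply: uM => //; lra.
have ip (v : 'rV[R]_n -> R) : (lebesgue_rV R n).-integrable Omega (EFin \o v) ->
    (lebesgue_rV R n).-integrable Omega (EFin \o (fun x => v x * phi1 x)).
  move=> iv; rewrite (_ : EFin \o _ = (fun x => (EFin \o v) x * (phi1 x)%:E)%E).
    exact: integrableMl.
  by apply/funext => x /=; rewrite EFinM.
have id : (lebesgue_rV R n).-integrable Omega (EFin \o (fun x => u x t - u0 x)).
  rewrite (_ : EFin \o _ = (fun x => (EFin \o (u ^~ t)) x - (EFin \o u0) x)%E).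
    exact: integrableB.
  by apply/funext => x /=; rewrite EFinB.
rewrite /average /average0 -RintegralB//; [|exact: ip..].
have idp := ip _ id.
under eq_Rintegral do rewrite -mulrBl.
apply: (le_trans (le_normr_Rintegral mO idp)).
have ia : (lebesgue_rV R n).-integrable Omega (EFin \o (fun x => `|u x t - u0 x|)).
  exact: (integrable_norm id).
apply: (@le_trans _ _ (P * \int[lebesgue_rV R n]_(x in Omega) `|u x t - u0 x|)).
  rewrite -RintegralZl//; apply: le_Rintegral => //.
  - exact: (integrable_norm idp).
  - rewrite (_ : EFin \o _ = (fun x => P%:E * (EFin \o (fun x => `|u x t - u0 x|)%R) x)%E).
      exact: integrableZl.
    by apply/funext => x /=; rewrite EFinM.
  - by move=> x Ox; rewrite normrM mulrC ler_wpM2r// phiP.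
move: le_t; rewrite sub0r normrN ger0_norm ?fine_ge0 ?integral_ge0// => le_t.
rewrite /Rintegral; apply: (@le_trans _ _ (P * (k / (P + 1)))).
  by rewrite ler_wpM2l.
by rewrite mulrCA ger_pMr// ler_pdivrMr// mul1r lerDl.
Qed.

Lemma average_near0 t2 (k : R) : I t2 -> 0 < k -> exists t1,
  [/\ 0 < t1, t1 <= t2, t1 <= k & `|average t1 - average0| <= k].
Proof.
move=> It2 k0; have [d d0 H] := average_cvg0 k k0.
have [t20 _] := It2; pose t1 := Num.min (d / 2) (Num.min t2 k).
have t10 : 0 < t1 by rewrite !lt_min t20 k0 divr_gt0.
have t1d : t1 < d by rewrite gt_min; apply/orP; left; lra.
have t12 : t1 <= t2 by rewrite !ge_min lexx !orbT.
have t1k : t1 <= k by rewrite !ge_min lexx !orbT.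
exists t1; split => //; apply: H; first by rewrite t10.
exact: I_down It2 t10 t12.
Qed.

Lemma average_lt1 t : I t -> average t < 1.
Proof.
move=> It; have [b1 /andP[b10 b11] win] := solution_window t It; have [t0 _] := It.
have [a [b [M [[/andP[_ at_] tb M0 bds] H]]]] := win t t0 (lexx t).
have tab : a < t < b by rewrite at_.
by have /andP[_ /le_lt_trans] := bds t tab; exact.
Qed.

(** With G an antiderivative of g, [travel_time] gives c (t2 - t1) <= G(E(t2)) - G(E(t1)). Letting
    t1 tend to 0 replaces E(t1) by E(0), and what remains is at most the integral of g from E(0) to
    1. *)
Lemma touchdown_le_integral (c : R) : 0 < c ->
  (forall w, w < 1 -> c * (g w)^-1 <= (lambda * delta1) * (g w)^-1 - mu1 * w) ->
  (T <= (1 / c)%:E *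
    \int[lebesgue_measure]_(s in [set s : R | average0 <= s < 1]%R) (g s)%:E)%E.
Proof.
move=> c0 Hc.
have X0 : (0 <= \int[lebesgue_measure]_(s in [set s : R | average0 <= s < 1]%R) (g s)%:E)%E.
  by apply: integral_ge0 => s /= /andP[_ s1]; rewrite lee_fin ltW// g_gt0.
(* An infinite integral makes the bound trivial, and -oo is excluded by positivity of g. *)
case: (\int[_]_(_ in _) _)%E X0 (@integral_g_ge R g hg g_gt0 ^~ average0) => [x|_ _|//]; last first.
  by rewrite gt0_muley ?leey// lte_fin divr_gt0.
rewrite lee_fin => x0 HX; rewrite -EFinM.
apply: le_of_time_interval; first by rewrite mulr_ge0// divr_ge0// ltW.
move=> t2 It2; rewrite mul1r ler_pdivlMl//.
have [b1 /andP[b10 b11] win] := solution_window t2 It2; have [t20 _] := It2.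
have E01 : average0 < 1.
  apply: le_lt_trans b11; apply: (@le_of_small _ _ _ 1) => // k k0.
  have [t1 [t10 t12 _ E1]] := average_near0 t2 k It2 k0.
  have [a [b [M [[/andP[_ at1] t2b M0 bds] H]]]] := win t1 t10 t12.
  have tab : a < t1 < b by rewrite at1 (le_lt_trans t12 t2b).
  have /andP[_] := bds t1 tab.
  by move: E1; rewrite ler_norml => /andP[? ?]; lra.
(* Times [t1] with E(t1) >= E(0) - 1 will be used, so g is at most [L] between E(t1) and E(0).
   Unlike [M], this bound does not depend on [t1]. The error is then c k for the time before [t1]
   plus [L] k for the initial value. *)
pose L := g (average0 - 1).
have L0 : 0 < L by apply: g_gt0; lra.
apply: (@le_of_small _ _ _ (c + L)); first by rewrite addr_ge0 ?ltW.
move=> k k0; pose k1 := Num.min k 1.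
have k10 : 0 < k1 by rewrite lt_min k0 ltr01.
have k1k : k1 <= k by rewrite ge_min lexx.
have k11 : k1 <= 1 by rewrite ge_min lexx orbT.
have [t1 [t10 t12 t1k E1]] := average_near0 t2 k1 It2 k10.
have [a [b [M [[/andP[_ at1] t2b M0 bds] H]]]] := win t1 t10 t12.
have Hc' e : 0 < e -> exists w dw : R -> R, forall t : R, a < t < b ->
    [/\ is_derive t 1 w (dw t), `|w t| <= M, w t <= b1, `|w t - average t| <= e &
        c * (g (w t))^-1 - e <= dw t].
  move=> e0; have [w [dw Hw]] := H e e0; exists w, dw => t tab.
  have [h1 h2 h3 h4 h5] := Hw t tab; split => //; apply: le_trans h5.
  by rewrite lerD2r; apply: Hc; exact: le_lt_trans b11.
(* The base point lies below both -M and E(0) - 1, so that one antiderivative serves all the values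
   involved. *)
pose p := Num.min (- M - 1) (average0 - 2).
have pM : p <= - M - 1 by rewrite ge_min lexx.
have pE : p <= average0 - 2 by rewrite ge_min lexx orbT.
have [G DG] := antiderivative_g g hg p.
have DGM s : - M <= s <= b1 -> is_derive s 1 G (g s).
  by move=> /andP[Ms sb]; apply: DG; apply/andP; split; lra.
have tt := travel_time g hg g_gt0 hg1 _ _ _ _ _ _ M0 b11 bds Hc' G t1 t2 at1 t12 t2b DGM.
have /andP[My yb] : - M <= average t2 <= b1.
  by apply: bds; rewrite t2b andbT; exact: lt_le_trans t12.
have /andP[Mz zb] : - M <= average t1 <= b1.
  by apply: bds; rewrite at1 (le_lt_trans t12 t2b).
have Gup r s : p < r -> r <= s -> s < 1 -> G r <= G s.
  move=> pr rs s1; rewrite -subr_ge0.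
  have := @derivative_ge _ G g 0 r s rs; rewrite mul0r; apply => z /andP[rz zs].
    by apply: DG; rewrite (lt_le_trans pr rz) (le_lt_trans zs s1).
  by rewrite ltW// g_gt0// (le_lt_trans zs).
(* If E(t2) <= E(0) the left side is at most 0; otherwise [E(0), E(t2)] is part of the range of
   integration. *)
have claim1 : G (average t2) - G average0 <= x.
  have [yE|Ey] := leP (average t2) average0.
    apply: le_trans x0; rewrite subr_le0; apply: Gup => //; lra.
  rewrite -lee_fin; apply: HX => //; first by lra.
  by move=> s /andP[Es sy]; apply: DG; apply/andP; split; lra.
have claim2 : G average0 - G (average t1) <= L * k1.
  have [Ez|/ltW zE] := leP average0 (average t1).
    apply: (@le_trans _ _ 0); last by rewrite mulr_ge0// ltW.
    rewrite subr_le0; apply: Gup => //; lra.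
  move: E1; rewrite ler_norml => /andP[E1 _].
  apply: (@le_trans _ _ (L * (average0 - average t1))); last first.
    by rewrite ler_pM2l//; lra.
  apply: (@derivative_le _ G g) => // s /andP[zs sE].
    by apply: DG; apply/andP; split; lra.
  by apply: (g_ni g hg g_gt0 hg1); lra.
have ct1 : c * t1 <= c * k1 by rewrite ler_pM2l.
have : k1 * (c + L) <= k * (c + L) by rewrite ler_pM2r// addr_gt0.
lra.
Qed.

(** Replacing 1/g by its tangent at a0 gives E' >= 10 + r (E - a0) with r >= 0. Starting from E(0)
    >= a0 this forces E(t) >= a0 + 10 t, while E(t) < 1 throughout. *)
Lemma touchdown_le_linear (a0 : R) : 0 < a0 < 1 -> a0 <= average0 ->
  mu1 + 10 <= lambda * delta1 * ((g a0)^-1 - (g 0)^-1) ->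
  (T <= ((1 - a0) / 10)%:E)%E.
Proof.
move=> /andP[a00 a01] aE Ha.
have c0 : 0 < lambda * delta1 by rewrite mulr_gt0.
pose h1 := - ((g a0)^-1 * (g a0)^-1) * derive1 g a0.
have h10 : 0 <= h1 := inv_g1_ge0 g g_gt0 hg1 a0 a01.
have tan s : s < 1 -> (g a0)^-1 + h1 * (s - a0) <= (g s)^-1.
  exact: (inv_g_tangent g hg g_gt0 hg2 a0 s a01).
have g0 : 0 < (g 0)^-1 by rewrite invr_gt0 g_gt0// ltr01.
(* The tangent at a0, evaluated at 0, bounds the slope from below, as 0 < a0 < 1. *)
have h1a : (g a0)^-1 - (g 0)^-1 <= h1.
  have := tan 0 ltr01; have : h1 * a0 <= h1 * 1 by rewrite ler_wpM2l// ltW.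
  lra.
(* Writing - mu1 w = - mu1 (w - a0) - mu1 a0 leaves this coefficient for w - a0; the hypothesis on
   a0 makes it nonnegative and the constant term at least 10. *)
pose r := lambda * delta1 * h1 - mu1.
have r0 : 0 <= r.
  have : lambda * delta1 * ((g a0)^-1 - (g 0)^-1) <= lambda * delta1 * h1.
    by rewrite ler_pM2l.
  rewrite /r; lra.
have m0 : 10 <= lambda * delta1 * (g a0)^-1 - mu1 * a0.
  have : 0 < lambda * delta1 * (g 0)^-1 by rewrite mulr_gt0.
  have : mu1 * a0 <= mu1 * 1 by rewrite ler_pM2l// ltW.
  by rewrite mulr1; move: Ha; rewrite mulrBr; lra.
apply: le_of_time_interval; first by rewrite divr_ge0// subr_ge0 ltW.
move=> t2 It2; have [t20 _] := It2.
have [b1 /andP[b10 b11] win] := solution_window t2 It2.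
have : 0 <= expR (- r * t2) * (average t2 - a0 - 10 * t2).
  (* One k from E(t1) being within k of E(0), ten from 10 [t1] with [t1] <= k. *)
  apply: (@le_of_small _ _ _ 11) => // k k0.
  have [t1 [t10 t12 t1k E1]] := average_near0 t2 k It2 k0.
  have [a [b [M [[/andP[a_gt0 at1] t2b M0 bds] H]]]] := win t1 t10 t12.
  have H' e : 0 < e -> exists w dw : R -> R, forall t : R, a < t < b ->
      [/\ is_derive t 1 w (dw t), `|w t - average t| <= e &
          10 + r * (w t - a0) - e <= dw t].
    move=> e0; have [w [dw Hw]] := H e e0; exists w, dw => t tab.
    have [h2 h3 h4 h5 h6] := Hw t tab; split => //; apply: le_trans h6.
    rewrite lerD2r; have w1 := le_lt_trans h4 b11.
    have : lambda * delta1 * ((g a0)^-1 + h1 * (w t - a0)) <= lambda * delta1 * (g (w t))^-1.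
      by rewrite ler_pM2l// tan.
    by rewrite /r; move: m0; lra.
  have := linear_growth 10 r a0 a b average t1 t2 (ler0n _ _) r0 (ltW a_gt0) H' at1 t12 t2b.
  have e1 : 0 < expR (- r * t1) <= 1.
    by rewrite expR_gt0 expR_le1 mulNr oppr_le0 mulr_ge0// ltW.
  move/andP: e1 => [e0 e1]; move: E1; rewrite ler_norml => /andP[E1 _].
  have : expR (- r * t1) * - (11 * k) <= expR (- r * t1) * (average t1 - a0 - 10 * t1).
    by rewrite ler_pM2l//; lra.
  have : expR (- r * t1) * (11 * k) <= 1 * (11 * k) by rewrite ler_pM2r// mulr_gt0.
  lra.
rewrite pmulr_rge0 ?expR_gt0// => pos; have := average_lt1 t2 It2.
rewrite ler_pdivlMr// => ?; lra.
Qed.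

End touchdown.

Theorem theorem3p3 (R : realType) (n : nat) (hn : (0 < n)%N)
    (Omega : set 'rV[R]_n) (hOmega : bounded_C2_domain Omega)
    (f : 'rV[R]_n -> R) (alpha : R) (halpha : 0 < alpha < 1)
    (hf0 : forall x, closure Omega x -> 0 <= f x)
    (hf : hoelder_on (closure Omega) alpha f)
    (delta1 : R) (hdelta1 : delta1 = inf [set f x | x in Omega])
    (hdelta1_gt0 : 0 < delta1)
    (g : R -> R) (hg : C2_below1 g)
    (hg_gt0 : forall s, s < 1 -> 0 < g s)
    (hg1 : forall s, s < 1 -> derive1 g s <= 0)
    (hg2 : forall s, s < 1 -> 0 <= derive1 (derive1 (fun r => (g r)^-1)) s)
    (mu1 : R) (hmu1 : first_dirichlet_eigenvalue Omega mu1)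
    (hmu1_gt0 : 0 < mu1)
    (phi1 : 'rV[R]_n -> R) (hphi1 : dirichlet_eigenfunction Omega mu1 phi1)
    (hphi1_gt0 : forall x, Omega x -> 0 < phi1 x)
    (hphi1_int : \int[lebesgue_rV R n]_(x in Omega) phi1 x = 1)
    (lambda1 : R)
    (hlambda1 : lambda1 =
       mu1 / delta1 * sup [set s * g s | s in [set s : R | 0 <= s < 1]]) :
  (forall (lambda : R) (u0 : 'rV[R]_n -> R) (T : \bar R)
      (u : 'rV[R]_n -> R -> R),
    lambda1 < lambda ->
    initial_datum Omega u0 ->
    is_solution Omega f g lambda u0 T u ->
    touchdown_time Omega u T ->
    let E0 := \int[lebesgue_rV R n]_(x in Omega) (u0 x * phi1 x) in
    (T <= (1 / ((lambda - lambda1) * delta1))%:E *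
          \int[lebesgue_measure]_(s in [set s : R | E0 <= s < 1]%R) (g s)%:E)%E)
  /\
  (g @ 1^'- --> (0 : R) ->
   forall lambda : R, 0 < lambda ->
   exists2 a0 : R, a0 < 1 &
     forall u0 : 'rV[R]_n -> R,
       initial_datum Omega u0 ->
       a0 <= \int[lebesgue_rV R n]_(x in Omega) (u0 x * phi1 x) ->
       forall (T : \bar R) (u : 'rV[R]_n -> R -> R),
         is_solution Omega f g lambda u0 T u ->
         touchdown_time Omega u T ->
         (T <= ((1 - a0) / 10)%:E)%E).
Proof.
have f_ge x : Omega x -> delta1 <= f x.
  (* [inf] is a lower bound only for sets bounded from below; here 0 is one. *)
  move=> Ox; rewrite hdelta1; apply: ge_inf; last by exists x.
  by exists 0 => _ [y Oy <-]; apply: hf0; exact: subset_closure.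
split.
- move=> lambda u0 T u l1 hu0 hu _ /=.
  pose S := sup [set s * g s | s in [set s : R | 0 <= s < 1]].
  (* [sup] is meaningful only for bounded sets. On [0, 1), s g(s) <= g(s) <= g(0). *)
  have ubS : has_ubound [set s * g s | s in [set s : R | 0 <= s < 1]].
    exists (g 0) => _ [s /= /andP[s0 s1] <-].
    have g0s : g s <= g 0 by apply: (g_ni g hg hg_gt0 hg1).
    by apply: (le_trans _ g0s); rewrite ler_piMl ?ltW// hg_gt0.
  have S_ge s : 0 <= s -> s < 1 -> s * g s <= S.
    by move=> s0 s1; apply: ub_le_sup => //; exists s => //=; rewrite s0.
  have S0 : 0 <= S by have := S_ge 0 (lexx _) ltr01; rewrite mul0r.
  have l10 : 0 <= lambda1 by rewrite hlambda1 mulr_ge0// divr_ge0// ltW.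
  have l0 : 0 < lambda := le_lt_trans l10 l1.
  apply: (touchdown_le_integral n Omega f delta1 mu1 lambda g phi1 u0 T u) => //.
    by rewrite mulr_gt0// subr_gt0.
  move=> w w1; have gw := hg_gt0 w w1.
  (* By the choice of lambda1 this says w g(w) <= [S]: true by definition for w >= 0, and for w < 0
     because the left side is nonpositive. *)
  have : mu1 * w <= lambda1 * delta1 * (g w)^-1.
    have -> : lambda1 * delta1 = mu1 * S by rewrite hlambda1 -/S; field; rewrite gt_eqF.
    rewrite -mulrA ler_pM2l// ler_pdivlMr//.
    have [w0|/ltW w0] := leP 0 w; first exact: S_ge.
    by apply: le_trans S0; rewrite mulr_le0_ge0// ltW.
  by rewrite mulrBl mulrBl; lra.
- move=> g_cvg0 lambda l0.
  have c0 : 0 < lambda * delta1 by rewrite mulr_gt0.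
  (* [N] is the value that 1/g(a0) must reach for the hypothesis of [touchdown_le_linear]; points a0
     in (0, 1) with g(a0) < 1/[N] exist since g tends to 0 at 1. *)
  pose N := (g 0)^-1 + (mu1 + 10) / (lambda * delta1).
  have N0 : 0 < N by rewrite addr_gt0 ?divr_gt0 ?invr_gt0 ?hg_gt0 ?addr_gt0.
  have [a0 [a00 a01 ga0]] : exists a0 : R, [/\ 0 < a0, a0 < 1 & g a0 < N^-1].
    have N1 : 0 < N^-1 by rewrite invr_gt0.
    have /cvgrPdist_lt /(_ _ N1) near_g := g_cvg0.
    have near_lt : \forall s \near (1:R)^'-, s < 1 by exact: nbhs_left_lt.
    have near_gt : \forall s \near (1:R)^'-, 0 < s by exact: nbhs_left_gt.
    have [s [[s0 s1] gs]] := filter_ex (filterI (filterI near_gt near_lt) near_g).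
    exists s; split => //; move: gs; rewrite sub0r normrN.
    by apply: le_lt_trans; exact: ler_norm.
  exists a0 => // u0 hu0 aE T u hu _.
  apply: (touchdown_le_linear n Omega f delta1 mu1 lambda g phi1 u0 T u) => //.
    by rewrite a00.
  have : N <= (g a0)^-1.
    by rewrite -[leLHS]invrK lef_pV2 ?posrE ?invr_gt0 ?hg_gt0// ltW.
  rewrite /N -lerBrDl ler_pdivrMr// mulrC; exact.
Qed.
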